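(* For each $p\in(1,\infty)$, the operator $\mathcal K_{\Lambda_L}$ is bounded on $\ell^p(\Lambda_L;\mathbb R^d)$, uniformly in $L\ge1$; i.e., $\sup_{L\ge1}\|\mathcal K_{\Lambda_L}\|_{\ell^p(\Lambda_L)\to\ell^p(\Lambda_L)}<\infty$.
   Context: $\hat e_1,\dots,\hat e_d$ are the unit vectors of $\mathbb R^d$; $\Lambda_L=\{0,\dots,L-1\}^d$. For $f:\mathbb Z^d\to\mathbb R$, $\nabla_if(x)=f(x+\hat e_i)-f(x)$ and $\nabla^\star_if(x)=f(x)-f(x-\hat e_i)$; $\nabla f=(\nabla_1f,\dots,\nabla_df)$; for $F=(F_1,\dots,F_d):\mathbb Z^d\to\mathbb R^d$, $\nabla^\star\cdot F=\sum_i\nabla^\star_iF_i$. $\Delta=\nabla^\star\cdot\nabla$ is the lattice Laplacian, $\Delta f(x)=\sum_{y:|y-x|=1}[f(y)-f(x)]$. For finite $\Lambda$, $(-\Delta)^{-1}_\Lambda$ denotes the inverse of $-\Delta$ on functions on $\Lambda$ with zero boundary condition (functions vanish outside $\Lambda$). The operator $\mathcal K_\Lambda=\nabla(-\Delta)^{-1}_\Lambda\nabla^\star$ acts on $F:\Lambda\to\mathbb R^d$ (extended by zero outside $\Lambda$) by $\mathcal K_\Lambda F=\nabla u$ restricted to $\Lambda$, where $u$ vanishes outside $\Lambda$ and $-\Delta u=\nabla^\star\cdot F$ in $\Lambda$. $\ell^p(\Lambda)$ norm: $\|F\|_p=(\sum_{x\in\Lambda}|F(x)|^p)^{1/p}$.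 *)

(* Defs.v *)
From Stdlib Require Import Reals ZArith List.
Open Scope R_scope.

(* Points of Z^d are lists of integers of length d. *)
Definition point := list Z.

Fixpoint upd (x : point) (i : nat) (k : Z) : point :=
  match x, i with
  | nil, _ => nil
  | a :: t, O => (a + k)%Z :: t
  | a :: t, S j => a :: upd t j k
  end.

Definition lsum (l : list R) : R := fold_right Rplus 0 l.

Definition sum_dir (d : nat) (g : nat -> R) : R := lsum (map g (seq 0 d)).

Fixpoint box (d L : nat) : list point :=
  match d with
  | O => nil :: nil
  | S d' => flat_map (fun z => map (cons z) (box d' L))
                     (map Z.of_nat (seq 0 L))
  end.

Definition inBox (d L : nat) (x : point) : Prop := In x (box d L).

Definition grad (f : point -> R) (x : point) (i : nat) : R :=
  f (upd x i 1) - f x.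

Definition div (d : nat) (F : point -> nat -> R) (x : point) : R :=
  sum_dir d (fun i => F x i - F (upd x i (-1)) i).

Definition lap (d : nat) (f : point -> R) (x : point) : R := div d (grad f) x.

Definition vnorm (d : nat) (v : nat -> R) : R := sqrt (sum_dir d (fun i => v i ^ 2)).

(* x^q for x >= 0, with 0^q = 0 (Rpower 0 q would be 1 in Stdlib) *)
Definition rpow (x q : R) : R := if Rle_dec x 0 then 0 else Rpower x q.

Definition lpnorm (d L : nat) (p : R) (F : point -> nat -> R) : R :=
  rpow (lsum (map (fun x => rpow (vnorm d (F x)) p) (box d L))) (/ p).

(* Main.v *)
Require Import Defs.
From Stdlib Require Import Reals ZArith List Lra Lia FunctionalExtensionality.
Open Scope R_scope.

(* Reflecting across the faces of the box turns the Dirichlet problem into the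
   equation [- Delta u = div F] on a discrete torus, where the lazy random walk [P]
   commutes with everything. With [u_n = P^n u], [g_n = P^n g] and [H_n = P^n (F + P F)],
   the pairing of [u_n] with the [j]-th backward difference of [g_n] drops at each step
   by [<div H_n, D_j g_n> / (2d+1)], and becomes small along a subsequence by the
   energy identity. The sum of the drops is controlled by a Bellman function
   [B(a, b) <= C (|a|^p + |b|^q)] for which [B + ab] and [B - ab] are both convex: the
   Jensen gap of [B] under one step of [P] dominates [|D_i H_i| |D_j g|], so the sum
   telescopes. [B] is a partial Legendre transform of Burkholder's zigzag-concave
   function for martingale transforms. Testing with [g = |D_j u|^(p-2) D_j u] gives the
   bound for every [p] at once, with no kernel estimates, duality or interpolation. *)

(** * Finite sums and real powers *)

(** Both factors of the pairing move together because the Bellman function has to see [H_n] and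
    [g_n] under the same step. Moving the second [P] across leaves [1 - P^2 = (1 + P)(1 - P)] acting
    on [u_n]; as [1 - P] is [- Delta / (2d+1)], this is where [F + P F] comes from. The main
    obstacle is the mixed directions: a drop multiplies a difference in direction [i] by one in
    direction [j], whereas convexity of [B + ab] and [B - ab] controls only the product of the
    increments of both functions between the same two points. The walk is lazy so that [x] and its
    backward neighbours in directions [i] and [j] occur in one average; the bounds over the three
    pairs they form then give the mixed product. Uniformity in [L]: the time at which the pairing
    becomes small depends on the torus, but serves only to remove an arbitrary error [e]. No
    spectral gap or mixing rate enters the constant, which is built from [d], [p] and the bound on
    [B]. *)

Notation Sum l f := (lsum (map f l)).

Lemma Sum_ext {T} (l : list T) (f g : T -> R) :
  (forall x, In x l -> f x = g x) -> Sum l f = Sum l g.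
Proof. intros H; f_equal; now apply map_ext_in. Qed.

Lemma Sum_le {T} (l : list T) (f g : T -> R) :
  (forall x, In x l -> f x <= g x) -> Sum l f <= Sum l g.
Proof.
induction l as [|a l IH]; simpl; intros H; [lra|].
apply Rplus_le_compat; [apply H; now left | apply IH; intros x Hx; apply H; now right].
Qed.

Lemma Sum_plus {T} (l : list T) (f g : T -> R) :
  Sum l (fun x => f x + g x) = Sum l f + Sum l g.
Proof. induction l as [|a l IH]; simpl; [lra | rewrite IH; ring]. Qed.

Lemma Sum_scal {T} (l : list T) (k : R) (f : T -> R) :
  Sum l (fun x => k * f x) = k * Sum l f.
Proof. induction l as [|a l IH]; simpl; [ring | rewrite IH; ring]. Qed.

Lemma Sum_minus {T} (l : list T) (f g : T -> R) :
  Sum l (fun x => f x - g x) = Sum l f - Sum l g.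
Proof. induction l as [|a l IH]; simpl; [lra | rewrite IH; ring]. Qed.

Lemma Sum_const {T} (l : list T) (k : R) : Sum l (fun _ => k) = INR (length l) * k.
Proof.
induction l as [|a l IH]; [simpl; ring|].
change (k + Sum l (fun _ => k) = INR (S (length l)) * k); rewrite IH, S_INR; ring.
Qed.

Lemma Sum_zero {T} (l : list T) (f : T -> R) :
  (forall x, In x l -> f x = 0) -> Sum l f = 0.
Proof. intros H; rewrite (Sum_ext l f (fun _ => 0) H), Sum_const; ring. Qed.

Lemma Sum_nonneg {T} (l : list T) (f : T -> R) :
  (forall x, In x l -> 0 <= f x) -> 0 <= Sum l f.
Proof.
intros H; rewrite <- (Sum_zero l (fun _ => 0)) by easy; now apply Sum_le.
Qed.

Lemma Sum_Rabs {T} (l : list T) (f : T -> R) :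
  Rabs (Sum l f) <= Sum l (fun x => Rabs (f x)).
Proof.
induction l as [|a l IH]; simpl; [rewrite Rabs_R0; lra|].
eapply Rle_trans; [apply Rabs_triang | lra].
Qed.

Lemma Sum_app {T} (l1 l2 : list T) (f : T -> R) :
  Sum (l1 ++ l2) f = Sum l1 f + Sum l2 f.
Proof. induction l1 as [|a l IH]; simpl; [ring | rewrite IH; ring]. Qed.

Lemma Sum_map {T U} (l : list T) (h : T -> U) (f : U -> R) :
  Sum (map h l) f = Sum l (fun x => f (h x)).
Proof. now rewrite map_map. Qed.

Lemma Sum_flat_map {T U} (l : list T) (h : T -> list U) (f : U -> R) :
  Sum (flat_map h l) f = Sum l (fun x => Sum (h x) f).
Proof. induction l as [|a l IH]; [easy|]; simpl; now rewrite Sum_app, IH. Qed.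

Lemma Sum_swap {T U} (l : list T) (k : list U) (f : T -> U -> R) :
  Sum l (fun x => Sum k (f x)) = Sum k (fun y => Sum l (fun x => f x y)).
Proof.
induction l as [|a l IH]; simpl; [now rewrite Sum_zero|].
now rewrite IH, <- Sum_plus.
Qed.

Lemma Sum_list_prod {T U} (l : list T) (k : list U) (f : T * U -> R) :
  Sum (list_prod l k) f = Sum l (fun x => Sum k (fun y => f (x, y))).
Proof. induction l as [|a l IH]; [easy|]; simpl; now rewrite Sum_app, Sum_map, IH. Qed.

Lemma Sum_ge_term {T} (l : list T) (f : T -> R) (x : T) :
  (forall y, In y l -> 0 <= f y) -> In x l -> f x <= Sum l f.
Proof.
induction l as [|a l IH]; intros H Hx; [easy|]; simpl.
assert (0 <= Sum l f) by (apply Sum_nonneg; intros y Hy; apply H; now right).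
assert (0 <= f a) by (apply H; now left).
destruct Hx as [->|Hx]; [lra|].
assert (f x <= Sum l f) by (apply IH; [intros y Hy; apply H; now right | easy]).
lra.
Qed.

Lemma rpow_pos (x q : R) : 0 < x -> rpow x q = Rpower x q.
Proof. intros H; unfold rpow; destruct (Rle_dec x 0); [lra | easy]. Qed.

Lemma rpow_0 (q : R) : rpow 0 q = 0.
Proof. unfold rpow; destruct (Rle_dec 0 0); [easy | lra]. Qed.

Lemma Rpower_gt0 (x q : R) : 0 < Rpower x q.
Proof. apply exp_pos. Qed.

Lemma rpow_nonneg (x q : R) : 0 <= rpow x q.
Proof.
unfold rpow; destruct (Rle_dec x 0); [lra | left; apply Rpower_gt0].
Qed.

Lemma rpow_mult_distr (x y q : R) :
  0 <= x -> 0 <= y -> rpow (x * y) q = rpow x q * rpow y q.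
Proof.
intros [Hx|<-] [Hy|<-];
  rewrite ?Rmult_0_l, ?Rmult_0_r, ?rpow_0, ?Rmult_0_l, ?Rmult_0_r; try easy.
rewrite !rpow_pos; try easy; [symmetry; now apply Rpower_mult_distr | now apply Rmult_lt_0_compat].
Qed.

Lemma rpow_plus (x q r : R) : 0 <= x -> rpow x q * rpow x r = rpow x (q + r).
Proof.
intros [Hx|<-]; [rewrite !rpow_pos by easy; now rewrite Rpower_plus | rewrite !rpow_0; ring].
Qed.

Lemma rpow_mult (x q r : R) : 0 <= x -> rpow (rpow x q) r = rpow x (q * r).
Proof.
intros [Hx|<-]; [|now rewrite !rpow_0].
rewrite (rpow_pos x) by easy; rewrite !rpow_pos; try easy; [apply Rpower_mult | apply Rpower_gt0].
Qed.

Lemma rpow_1 (x : R) : 0 <= x -> rpow x 1 = x.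
Proof. intros [Hx|<-]; [rewrite rpow_pos by easy; now apply Rpower_1 | apply rpow_0]. Qed.

Lemma rpow_base1 (q : R) : rpow 1 q = 1.
Proof.
rewrite rpow_pos by lra; unfold Rpower; rewrite ln_1, Rmult_0_r; apply exp_0.
Qed.

Lemma rpow_le (x y q : R) : 0 <= q -> 0 <= x <= y -> rpow x q <= rpow y q.
Proof.
intros Hq [[Hx|<-] Hxy]; [|rewrite rpow_0; apply rpow_nonneg].
rewrite !rpow_pos by lra; apply Rle_Rpower_l; lra.
Qed.

Lemma rpow_succ (x q : R) : 0 <= x -> rpow x (q - 1) * x = rpow x q.
Proof.
intros Hx; rewrite <- (rpow_1 x Hx) at 2; rewrite rpow_plus by easy; f_equal; ring.
Qed.

Lemma Sum_max {T} (l : list T) (f : T -> R) :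
  l <> nil -> exists y, In y l /\ Sum l f <= INR (length l) * f y.
Proof.
induction l as [|a l IH]; [easy|]; intros _.
destruct l as [|b l]; [exists a; simpl; split; [auto | lra]|].
destruct IH as (y & Hy & H); [easy|].
pose proof (pos_INR (length (b :: l))).
change (Sum (a :: b :: l) f) with (f a + Sum (b :: l) f).
change (length (a :: b :: l)) with (S (length (b :: l))); rewrite S_INR.
destruct (Rle_dec (f a) (f y)).
- exists y; split; [now right | nra].
- exists a; split; [now left | nra].
Qed.

(** Comparison with the largest term. The factor is worse than Jensen's, but the argument covers
    every [p >= 0]. *)
Lemma rpow_Sum_le {T} (l : list T) (f : T -> R) (p : R) :
  0 <= p -> (forall x, In x l -> 0 <= f x) ->
  rpow (Sum l f) p <= rpow (INR (length l)) p * Sum l (fun x => rpow (f x) p).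
Proof.
intros Hp Hf; destruct l as [|a l]; [simpl; rewrite !rpow_0; lra|].
destruct (Sum_max (a :: l) f) as (y & Hy & H); [easy|].
apply Rle_trans with (rpow (INR (length (a :: l)) * f y) p).
- apply rpow_le; [easy | split; [now apply Sum_nonneg | easy]].
- rewrite rpow_mult_distr by (apply pos_INR || now apply Hf).
  apply Rmult_le_compat_l; [apply rpow_nonneg|].
  apply (Sum_ge_term (a :: l) (fun x => rpow (f x) p)); [intros; apply rpow_nonneg | easy].
Qed.

(** * The Bellman function *)

(** A supporting line at every point, which for a finite function on the real line is convexity. In
    this form Jensen's inequality, sums and affine substitutions are immediate. *)
Definition subdifferentiable (f : R -> R) : Prop :=
  forall t0, exists m, forall t, f t0 + m * (t - t0) <= f t.

Lemma subdifferentiable_plus (f g : R -> R) :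
  subdifferentiable f -> subdifferentiable g -> subdifferentiable (fun t => f t + g t).
Proof.
intros Hf Hg t0; destruct (Hf t0) as [m Hm], (Hg t0) as [n Hn].
exists (m + n); intros t; specialize (Hm t); specialize (Hn t); lra.
Qed.

Lemma subdifferentiable_affine (f : R -> R) (k a b : R) :
  0 <= k -> subdifferentiable f -> subdifferentiable (fun t => k * f (a * t + b)).
Proof.
intros Hk Hf t0; destruct (Hf (a * t0 + b)) as [m Hm].
exists (k * (m * a)); intros t; specialize (Hm (a * t + b)).
apply Rle_trans with (k * (f (a * t0 + b) + m * (a * t + b - (a * t0 + b)))).
- right; ring.
- now apply Rmult_le_compat_l.
Qed.

Lemma subdifferentiable_ext (f g : R -> R) :
  (forall t, f t = g t) -> subdifferentiable f -> subdifferentiable g.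
Proof.
intros H Hf t0; destruct (Hf t0) as [m Hm]; exists m; intros t; rewrite <- !H; apply Hm.
Qed.

Lemma derivative_monotone (g g' : R -> R) (lo : R) :
  (forall t, lo <= t -> derivable_pt_lim g t (g' t)) ->
  (forall t, lo <= t -> 0 <= g' t) ->
  forall s t, lo <= s <= t -> g s <= g t.
Proof.
intros Hg Hm s t [Hs [Hst| <-]]; [|lra].
destruct (MVT_cor2 g g' s t Hst) as (x & Hx & Hsx); [intros; apply Hg; lra|].
assert (0 <= g' x) by (apply Hm; lra); nra.
Qed.

Lemma tangent_below (g g' : R -> R) (lo : R) :
  (forall t, lo <= t -> derivable_pt_lim g t (g' t)) ->
  (forall s t, lo <= s <= t -> g' s <= g' t) ->
  forall t0 t, lo <= t0 -> lo <= t -> g t0 + g' t0 * (t - t0) <= g t.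
Proof.
intros Hg Hm t0 t H0 Ht; destruct (Rtotal_order t0 t) as [H|[<-|H]]; [|lra|].
- destruct (MVT_cor2 g g' t0 t H) as (x & Hx & Hsx); [intros; apply Hg; lra|].
  assert (g' t0 <= g' x) by (apply Hm; lra); nra.
- destruct (MVT_cor2 g g' t t0 H) as (x & Hx & Hsx); [intros; apply Hg; lra|].
  assert (g' x <= g' t0) by (apply Hm; lra); nra.
Qed.

Lemma derivable_pt_lim_Rpower (q t : R) :
  0 < t -> derivable_pt_lim (fun t => Rpower t q) t (q * Rpower t (q - 1)).
Proof. intros; now apply derivable_pt_lim_power. Qed.

Lemma derivable_pt_lim_eq (f : R -> R) (x l l' : R) :
  derivable_pt_lim f x l -> l = l' -> derivable_pt_lim f x l'.
Proof. now intros H <-. Qed.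

Lemma Rpower_base1 (q : R) : Rpower 1 q = 1.
Proof. unfold Rpower; rewrite ln_1, Rmult_0_r; apply exp_0. Qed.

(** Bernoulli's inequality is the supporting line at [1]; scaling by [t0] carries it to every other
    nonzero point, and at [0] the slope [0] serves. *)
Lemma subdifferentiable_Rabs_rpow (p : R) :
  1 < p -> subdifferentiable (fun t => rpow (Rabs t) p).
Proof.
intros Hp.
assert (Bernoulli : forall s, 1 + p * (s - 1) <= rpow (Rabs s) p).
{ intros s; pose proof (rpow_nonneg (Rabs s) p).
  destruct (Rle_dec s 0) as [Hs|Hs]; [nra|].
  rewrite Rabs_pos_eq, rpow_pos by lra.
  destruct (Rtotal_order s 1) as [H1|[->|H1]].
  - destruct (MVT_cor2 (fun t => Rpower t p) (fun t => p * Rpower t (p - 1)) s 1 H1)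
      as (x & Hx & Hsx); [intros; apply derivable_pt_lim_Rpower; lra|].
    assert (Rpower x (p - 1) <= Rpower 1 (p - 1)) by (apply Rle_Rpower_l; lra).
    rewrite Rpower_base1 in *.
    assert (p * Rpower x (p - 1) <= p * 1) by (apply Rmult_le_compat_l; lra).
    nra.
  - rewrite Rpower_base1; lra.
  - destruct (MVT_cor2 (fun t => Rpower t p) (fun t => p * Rpower t (p - 1)) 1 s H1)
      as (x & Hx & Hsx); [intros; apply derivable_pt_lim_Rpower; lra|].
    assert (Rpower 1 (p - 1) <= Rpower x (p - 1)) by (apply Rle_Rpower_l; lra).
    rewrite Rpower_base1 in *.
    assert (p * 1 <= p * Rpower x (p - 1)) by (apply Rmult_le_compat_l; lra).
    nra. }
intros t0; destruct (Req_dec t0 0) as [->|H0].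
- exists 0; intros t; rewrite Rabs_R0, rpow_0; pose proof (rpow_nonneg (Rabs t) p); lra.
- exists (rpow (Rabs t0) p * p / t0); intros t.
  replace (Rabs t) with (Rabs t0 * Rabs (t / t0))
    by (rewrite <- Rabs_mult; f_equal; field; easy).
  rewrite rpow_mult_distr by apply Rabs_pos.
  apply Rle_trans with (rpow (Rabs t0) p * (1 + p * (t / t0 - 1))).
  + right; field; easy.
  + apply Rmult_le_compat_l; [apply rpow_nonneg | apply Bernoulli].
Qed.

(** What the negative of Burkholder's function adds to an affine function along a line of slope one,
    once the two arguments have equal signs; [e] tells the two ends of the line apart. *)
Definition burkholder_tail (p l e t : R) : R :=
  if Rle_dec t 1 then 0
  else l * (Rpower t p - 1) - e * (Rpower t (p - 1) - t).

(** For [t >= 1] the second derivative has the sign of [l p t - e (p - 2)], and the slope at [1] is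
    [l p - e (p - 2)]. Both are nonnegative for both signs of [e] because [l p = |p - 2|], so the
    gluing with [0] at [t = 1] stays convex. *)
Lemma subdifferentiable_burkholder_tail (p l e : R) :
  1 < p -> l * p = Rabs (p - 2) -> (e = 1 \/ e = -1) ->
  subdifferentiable (burkholder_tail p l e).
Proof.
intros Hp Hl He.
assert (Hlp : e * (p - 2) <= l * p).
{ rewrite Hl; destruct He as [->| ->]; [rewrite Rmult_1_l; apply Rle_abs|].
  replace (-1 * (p - 2)) with (- (p - 2)) by ring; rewrite <- Rabs_Ropp; apply Rle_abs. }
assert (Hlp0 : 0 <= l * p) by (rewrite Hl; apply Rabs_pos).
set (g := fun t => l * (Rpower t p - 1) - e * (Rpower t (p - 1) - t)).
set (g' := fun t => l * p * Rpower t (p - 1) - e * ((p - 1) * Rpower t (p - 1 - 1) - 1)).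
set (g'' := fun t => (p - 1) * Rpower t (p - 1 - 1 - 1) * (l * p * t - e * (p - 2))).
assert (Dg : forall t, 1 <= t -> derivable_pt_lim g t (g' t)).
{ intros t Ht; eapply derivable_pt_lim_eq.
  - apply derivable_pt_lim_minus; apply derivable_pt_lim_scal;
      apply derivable_pt_lim_minus.
    + apply derivable_pt_lim_Rpower; lra.
    + apply derivable_pt_lim_const.
    + apply derivable_pt_lim_Rpower; lra.
    + apply derivable_pt_lim_id.
  - unfold g'; ring. }
assert (Dg' : forall t, 1 <= t -> derivable_pt_lim g' t (g'' t)).
{ intros t Ht; eapply derivable_pt_lim_eq.
  - apply derivable_pt_lim_minus; apply derivable_pt_lim_scal.
    + apply derivable_pt_lim_Rpower; lra.
    + apply derivable_pt_lim_minus; [|apply derivable_pt_lim_const].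
      apply derivable_pt_lim_scal; apply derivable_pt_lim_Rpower; lra.
  - unfold g''.
    replace (Rpower t (p - 1 - 1)) with (Rpower t (p - 1 - 1 - 1) * t); [ring|].
    rewrite <- (Rpower_1 t) at 2 by lra; rewrite <- Rpower_plus; f_equal; ring. }
assert (Mg' : forall s t, 1 <= s <= t -> g' s <= g' t).
{ apply derivative_monotone with g''; [easy|].
  intros t Ht; unfold g''; pose proof (Rpower_gt0 t (p - 1 - 1 - 1)).
  apply Rmult_le_pos; [apply Rmult_le_pos; lra | nra]. }
assert (G1 : g 1 = 0) by (unfold g; rewrite !Rpower_base1; ring).
assert (G'1 : forall t, 1 <= t -> 0 <= g' t).
{ intros t Ht; apply Rle_trans with (g' 1); [|apply Mg'; lra].
  unfold g'; rewrite !Rpower_base1; lra. }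
assert (Tg := tangent_below g g' 1 Dg Mg').
assert (Eq : forall t, burkholder_tail p l e t = if Rle_dec t 1 then 0 else g t) by easy.
intros t0; rewrite Eq; destruct (Rle_dec t0 1) as [H0|H0].
- exists 0; intros t; rewrite Eq; destruct (Rle_dec t 1) as [H|H]; [lra|].
  assert (g 1 <= g t); [|lra].
  apply (derivative_monotone g g' 1); [easy | easy | lra].
- exists (g' t0); intros t; rewrite Eq.
  assert (Hg0 : 0 <= g' t0) by (apply G'1; lra).
  destruct (Rle_dec t 1) as [H|H].
  + assert (g t0 + g' t0 * (1 - t0) <= g 1) by (apply Tg; lra).
    assert (g' t0 * (t - t0) <= g' t0 * (1 - t0)) by (apply Rmult_le_compat_l; lra).
    lra.
  + apply Tg; lra.
Qed.

(** A positive multiple of Burkholder's [(|a| + |c|)^(p-1) (|c| - (max(p, q) - 1) |a|)], with [q]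
    the exponent conjugate to [p]: for [l = |p - 2| / p] the ratio [(1 + l) / (1 - l)] equals
    [max(p, q) - 1]. *)
Definition burkholder (p l a c : R) : R :=
  rpow (Rabs a + Rabs c) (p - 1) * ((1 - l) * Rabs c - (1 + l) * Rabs a).

(** For [-1 <= s <= 0] the arguments have opposite signs and [|s| + |1 + s| = 1], so the function is
    affine there; each tail takes over at one end of that interval. *)
Lemma burkholder_diagonal (p l s : R) :
  1 < p ->
  - burkholder p l s (1 + s) =
  l - (2 * s + 1) + burkholder_tail p l 1 (2 * s + 1)
    + burkholder_tail p l (-1) (- (2 * s + 1)).
Proof.
intros Hp; unfold burkholder, burkholder_tail.
assert (Hs : forall x, 0 < x -> Rpower x p = Rpower x (p - 1) * x).
{ intros x Hx; rewrite <- (Rpower_1 x) at 3 by easy; rewrite <- Rpower_plus; f_equal; ring. }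
destruct (Rle_dec (2 * s + 1) 1) as [H1|H1];
  destruct (Rle_dec (- (2 * s + 1)) 1) as [H2|H2]; try lra.
- rewrite (Rabs_left1 s), (Rabs_pos_eq (1 + s)) by lra.
  replace (- s + (1 + s)) with 1 by ring; rewrite rpow_base1; ring.
- rewrite (Rabs_left1 s), (Rabs_left1 (1 + s)) by lra.
  replace (- s + - (1 + s)) with (- (2 * s + 1)) by ring.
  rewrite rpow_pos, Hs by lra; ring.
- rewrite (Rabs_pos_eq s), (Rabs_pos_eq (1 + s)) by lra.
  replace (s + (1 + s)) with (2 * s + 1) by ring.
  rewrite rpow_pos, Hs by lra; ring.
Qed.

Lemma burkholder_homogeneous (p l t a c : R) :
  burkholder p l (t * a) (t * c) = rpow (Rabs t) p * burkholder p l a c.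
Proof.
unfold burkholder; rewrite !Rabs_mult, <- Rmult_plus_distr_l.
pose proof (Rabs_pos t); pose proof (Rabs_pos a); pose proof (Rabs_pos c).
rewrite rpow_mult_distr by lra; rewrite <- (rpow_succ (Rabs t) p) by easy; ring.
Qed.

(** Homogeneity reduces the line to [c = 1], where the decomposition into an affine part and two
    tails applies. The degenerate line [c = 0] gives a multiple of [|a|^p]. *)
Lemma burkholder_zigzag (p l c : R) :
  1 < p -> 0 <= l -> l * p = Rabs (p - 2) ->
  subdifferentiable (fun a => - burkholder p l a (c + a)).
Proof.
intros Hp Hl0 Hl; destruct (Req_dec c 0) as [->|Hc].
- apply subdifferentiable_ext with (fun a => rpow 2 (p - 1) * (2 * l) * rpow (Rabs (1 * a + 0)) p).
  + intros a; rewrite Rplus_0_l, Rplus_0_r, Rmult_1_l; unfold burkholder.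
    pose proof (Rabs_pos a).
    replace (Rabs a + Rabs a) with (2 * Rabs a) by ring.
    rewrite rpow_mult_distr, <- (rpow_succ (Rabs a) p) by lra; ring.
  + apply (subdifferentiable_affine (fun t => rpow (Rabs t) p)).
    * pose proof (rpow_nonneg 2 (p - 1)); apply Rmult_le_pos; lra.
    * now apply subdifferentiable_Rabs_rpow.
- apply subdifferentiable_ext with
    (fun a => rpow (Rabs c) p * (fun s => - burkholder p l s (1 + s)) (/ c * a + 0)).
  + intros a.
    replace (burkholder p l a (c + a))
      with (burkholder p l (c * (/ c * a + 0)) (c * (1 + (/ c * a + 0))))
      by (f_equal; field; easy).
    rewrite burkholder_homogeneous; ring.
  + apply (subdifferentiable_affine (fun s => - burkholder p l s (1 + s))); [apply rpow_nonneg|].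
    apply subdifferentiable_ext with
      (fun s => (l - (2 * s + 1)) + 1 * burkholder_tail p l 1 (2 * s + 1)
         + 1 * burkholder_tail p l (-1) (-2 * s + -1)).
    { intros s; rewrite burkholder_diagonal by easy.
      replace (-2 * s + -1) with (- (2 * s + 1)) by ring; ring. }
    apply subdifferentiable_plus; [apply subdifferentiable_plus|].
    * intros t0; exists (-2); intros t; lra.
    * apply (subdifferentiable_affine (burkholder_tail p l 1)); [lra|].
      apply subdifferentiable_burkholder_tail; auto.
    * apply (subdifferentiable_affine (burkholder_tail p l (-1))); [lra|].
      apply subdifferentiable_burkholder_tail; auto.
Qed.

Lemma burkholder_opp (p l a c : R) : burkholder p l a (- c) = burkholder p l a c.
Proof. unfold burkholder; now rewrite Rabs_Ropp. Qed.

Lemma burkholder_ge (p l : R) :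
  1 < p -> 0 <= l < 1 ->
  exists k K, 0 < k /\ 0 <= K /\
    forall a c, k * rpow (Rabs c) p - K * rpow (Rabs a) p <= burkholder p l a c.
Proof.
intros Hp Hl.
(* Beyond the ratio [|c| = r |a|] the negative term costs at most half of the positive one; below it
   every power of [|c|] is absorbed in [|a|^p]. *)
set (r := 2 * (1 + l) / (1 - l)).
assert (Hr : r * (1 - l) = 2 * (1 + l)) by (unfold r; field; lra).
assert (Hr0 : 0 < r) by (unfold r; apply Rdiv_lt_0_compat; lra).
exists ((1 - l) / 2), ((1 + l) * rpow (1 + r) (p - 1) + (1 - l) / 2 * rpow r p).
pose proof (rpow_nonneg (1 + r) (p - 1)); pose proof (rpow_nonneg r p).
split; [lra|]; split; [nra|].
intros a c; unfold burkholder; pose proof (Rabs_pos a); pose proof (Rabs_pos c).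
generalize dependent (Rabs a); generalize dependent (Rabs c); clear a c.
intros c Hc a Ha.
destruct (Rle_dec (r * a) c) as [H1|H1].
- apply Rle_trans with ((1 - l) / 2 * rpow c p).
  { assert (0 <= ((1 + l) * rpow (1 + r) (p - 1) + (1 - l) / 2 * rpow r p) * rpow a p); [|lra].
    pose proof (rpow_nonneg a p); apply Rmult_le_pos; [nra | easy]. }
  rewrite <- (rpow_succ c p) by easy.
  apply Rle_trans with (rpow c (p - 1) * ((1 - l) / 2 * c)); [right; ring|].
  apply Rmult_le_compat; [apply rpow_nonneg | nra | apply rpow_le; lra |].
  assert ((r * a) * (1 - l) <= c * (1 - l)) by (apply Rmult_le_compat_r; lra).
  nra.
- assert (Hp1 : rpow c p <= rpow r p * rpow a p).
  { rewrite <- rpow_mult_distr by lra; apply rpow_le; lra. }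
  assert (Hp2 : rpow (a + c) (p - 1) <= rpow (1 + r) (p - 1) * rpow a (p - 1)).
  { rewrite <- rpow_mult_distr by lra; apply rpow_le; lra. }
  rewrite <- (rpow_succ a p) in * by easy.
  pose proof (rpow_nonneg (a + c) (p - 1)); pose proof (rpow_nonneg a (p - 1)).
  assert (rpow (a + c) (p - 1) * ((1 + l) * a)
          <= rpow (1 + r) (p - 1) * rpow a (p - 1) * ((1 + l) * a))
    by (apply Rmult_le_compat_r; [nra | easy]).
  assert (0 <= rpow (a + c) (p - 1) * ((1 - l) * c)) by (apply Rmult_le_pos; nra).
  nra.
Qed.

(** Either [|b| <= k |c|^(p-1)] and the left side is at most zero, or [|c|] is at most
    [(|b| / k)^(1/(p-1))], which is the source of the constant. *)
Lemma Young_crude (p k : R) :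
  1 < p -> 0 < k ->
  exists K, 0 <= K /\
    forall b c, b * c - k * rpow (Rabs c) p <= K * rpow (Rabs b) (p / (p - 1)).
Proof.
intros Hp Hk; exists (rpow (/ k) (/ (p - 1))); split; [apply rpow_nonneg|].
intros b c.
apply Rle_trans with (Rabs b * Rabs c - k * rpow (Rabs c) p).
{ rewrite <- Rabs_mult; pose proof (Rle_abs (b * c)); lra. }
pose proof (Rabs_pos b); pose proof (Rabs_pos c).
generalize dependent (Rabs b); generalize dependent (Rabs c); clear b c.
intros c Hc b Hb.
assert (Hk' : 0 < / k) by now apply Rinv_0_lt_compat.
pose proof (rpow_nonneg (/ k) (/ (p - 1))); pose proof (rpow_nonneg b (p / (p - 1))).
destruct (Rle_dec b (k * rpow c (p - 1))) as [H1|H1].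
- rewrite <- (rpow_succ c p) by easy.
  apply Rle_trans with 0; [|now apply Rmult_le_pos].
  assert (b * c <= k * rpow c (p - 1) * c) by now apply Rmult_le_compat_r.
  lra.
- assert (Hc' : c <= rpow (/ k) (/ (p - 1)) * rpow b (/ (p - 1))).
  { replace c with (rpow (rpow c (p - 1)) (/ (p - 1))) at 1
      by (rewrite rpow_mult, Rinv_r by lra; now apply rpow_1).
    rewrite <- rpow_mult_distr by lra.
    apply rpow_le; [left; apply Rinv_0_lt_compat; lra|].
    split; [apply rpow_nonneg|].
    apply Rmult_le_reg_l with k; [easy|].
    rewrite <- Rmult_assoc, Rinv_r, Rmult_1_l by lra; lra. }
  apply Rle_trans with (b * c).
  { pose proof (rpow_nonneg c p); nra. }
  apply Rle_trans with (b * (rpow (/ k) (/ (p - 1)) * rpow b (/ (p - 1)))).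
  { now apply Rmult_le_compat_l. }
  right; replace (p / (p - 1)) with (1 + / (p - 1)) by (field; lra).
  rewrite <- rpow_plus, rpow_1 by easy; ring.
Qed.

(** * Means, Jensen's inequality and the construction of the Bellman function *)

Definition mean {T} (l : list T) (f : T -> R) : R := Sum l f / INR (length l).

(** Joint convexity, stated for uniform means over finite lists, repetitions allowed. The type of
    indices is arbitrary, so it covers both the steps of the walk and pairs of steps. *)
Definition jensen (B : R -> R -> R) : Prop :=
  forall (T : Type) (l : list T) (a b : T -> R), l <> nil ->
    B (mean l a) (mean l b) <= mean l (fun s => B (a s) (b s)).

Lemma length_pos {T} (l : list T) : l <> nil -> 0 < INR (length l).
Proof. destruct l; [easy|]; intros _; apply lt_0_INR; simpl; lia. Qed.

Lemma mean_le {T} (l : list T) (f g : T -> R) :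
  l <> nil -> (forall x, In x l -> f x <= g x) -> mean l f <= mean l g.
Proof.
intros Hl H; unfold mean, Rdiv; apply Rmult_le_compat_r.
- left; apply Rinv_0_lt_compat; now apply length_pos.
- now apply Sum_le.
Qed.

Lemma mean_plus {T} (l : list T) (f g : T -> R) :
  mean l (fun x => f x + g x) = mean l f + mean l g.
Proof. unfold mean; rewrite Sum_plus; unfold Rdiv; ring. Qed.

Lemma mean_scal {T} (l : list T) (k : R) (f : T -> R) :
  mean l (fun x => k * f x) = k * mean l f.
Proof. unfold mean; rewrite Sum_scal; unfold Rdiv; ring. Qed.

Lemma mean_const {T} (l : list T) (k : R) : l <> nil -> mean l (fun _ => k) = k.
Proof.
intros H; apply length_pos in H; unfold mean; rewrite Sum_const; field; lra.
Qed.

Lemma mean_ext {T} (l : list T) (f g : T -> R) :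
  (forall x, In x l -> f x = g x) -> mean l f = mean l g.
Proof. intros H; unfold mean; now rewrite (Sum_ext l f g). Qed.

Lemma subdifferentiable_jensen (f : R -> R) {T} (l : list T) (a : T -> R) :
  subdifferentiable f -> l <> nil -> f (mean l a) <= mean l (fun s => f (a s)).
Proof.
intros Hf Hl; destruct (Hf (mean l a)) as [m Hm].
apply Rle_trans with (mean l (fun s => (f (mean l a) - m * mean l a) + m * a s)).
- rewrite mean_plus, mean_scal, mean_const by easy; lra.
- apply mean_le; [easy|]; intros x _; specialize (Hm (a x)); lra.
Qed.

(* A supremum of functions affine in [b] and convex in [a] is jointly convex. *)
Lemma sup_jensen (B : R -> R -> R) (k : R -> R -> R) :
  (forall a b, is_lub (fun r => exists c, r = b * c + k c a) (B a b)) ->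
  (forall c, subdifferentiable (k c)) -> jensen B.
Proof.
intros HB Hk T l a b Hl.
apply (HB (mean l a) (mean l b)); intros r (c & ->).
apply Rle_trans with (mean l (fun s => c * b s + k c (a s))).
- rewrite mean_plus, mean_scal.
  pose proof (subdifferentiable_jensen (k c) l a (Hk c) Hl); lra.
- apply mean_le; [easy|]; intros s _; apply (HB (a s) (b s)); exists c; ring.
Qed.

Lemma is_lub_shift (E E' : R -> Prop) (m k : R) :
  (forall r, E' r <-> E (r - k)) -> is_lub E m -> is_lub E' (m + k).
Proof.
intros H [Hu Hl]; split.
- intros r Hr; apply H, Hu in Hr; lra.
- intros b Hb; assert (m <= b - k); [|lra].
  apply Hl; intros r Hr; assert (E' (r + k)).
  { apply H; now replace (r + k - k) with r by ring. }
  apply Hb in H0; lra.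
Qed.

(* [B a b] is the supremum of [b c - burkholder a c] over [c]; adding [a b] or
   [- a b] shifts [c] by [a], which turns the zigzag concavity of Burkholder's
   function into joint convexity. *)
Lemma bellman (p : R) :
  1 < p -> exists (B : R -> R -> R) (C : R), 0 <= C /\
    (forall a b, 0 <= B a b <= C * (rpow (Rabs a) p + rpow (Rabs b) (p / (p - 1)))) /\
    jensen (fun a b => B a b + a * b) /\ jensen (fun a b => B a b - a * b).
Proof.
intros Hp.
set (l := Rabs (p - 2) / p).
assert (Hlp : l * p = Rabs (p - 2)) by (unfold l; field; lra).
assert (Hl : 0 <= l < 1).
{ assert (0 <= l * p) by (rewrite Hlp; apply Rabs_pos).
  assert (l * p < 1 * p) by (rewrite Hlp; apply Rabs_def1; lra).
  split; nra. }
destruct (burkholder_ge p l Hp Hl) as (k & K & Hk & HK & HU).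
destruct (Young_crude p k Hp Hk) as (K' & HK' & HY).
set (E := fun a b r => exists c, r = b * c - burkholder p l a c).
assert (Hub : forall a b, is_upper_bound (E a b)
  (K * rpow (Rabs a) p + K' * rpow (Rabs b) (p / (p - 1)))).
{ intros a b r (c & ->); specialize (HU a c); specialize (HY b c); lra. }
(* Completeness returns the supremum as data, so [B] is an actual function. Finiteness holds because
   [k |c|^p] dominates [b c]. *)
assert (Hlub : forall a b, {m | is_lub (E a b) m}).
{ intros a b; apply completeness; [eexists; apply Hub | exists (b * 0 - burkholder p l a 0); now exists 0]. }
exists (fun a b => proj1_sig (Hlub a b)), (K + K'); split; [lra|].
assert (HB : forall a b, is_lub (E a b) (proj1_sig (Hlub a b)))
  by (intros a b; apply proj2_sig).
set (B := fun a b => proj1_sig (Hlub a b)) in *.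
change (forall a b, is_lub (E a b) (B a b)) in HB.
split; [|split].
- intros a b; change (0 <= B a b <= (K + K') * (rpow (Rabs a) p + rpow (Rabs b) (p / (p - 1)))).
  split.
  (* The competitor [c = 0] contributes [(1 + l) |a|^p], which is nonnegative. *)
  + apply Rle_trans with (b * 0 - burkholder p l a 0); [|apply HB; now exists 0].
    unfold burkholder; rewrite Rabs_R0; pose proof (Rabs_pos a).
    assert (0 <= rpow (Rabs a + 0) (p - 1) * ((1 + l) * Rabs a)); [|lra].
    apply Rmult_le_pos; [apply rpow_nonneg | nra].
  + eapply Rle_trans; [apply (HB a b), Hub|].
    pose proof (rpow_nonneg (Rabs a) p); pose proof (rpow_nonneg (Rabs b) (p / (p - 1))); nra.
(* The shift leads to the second argument [c - a], on a line of slope minus one; evenness in that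
   argument turns it into [- c + a], of slope one. *)
- apply (sup_jensen (fun a b => B a b + a * b) (fun c a => - burkholder p l a (- c + a))).
  + intros a b; apply is_lub_shift with (E a b); [|apply HB].
    intros r; split; intros (c & Hc).
    * exists (c - a); rewrite Hc.
      replace (- c + a) with (- (c - a)) by ring; rewrite burkholder_opp; ring.
    * exists (c + a).
      replace (- (c + a) + a) with (- c) by ring; rewrite burkholder_opp; lra.
  + intros c; apply burkholder_zigzag; lra.
- apply (sup_jensen (fun a b => B a b - a * b) (fun c a => - burkholder p l a (c + a))).
  + intros a b; apply is_lub_shift with (E a b); [|apply HB].
    intros r; split; intros (c & Hc).
    * exists (c + a); rewrite Hc; ring_simplify; lra.
    * exists (c - a).
      replace (c - a + a) with c by ring; lra.
  + intros c; apply burkholder_zigzag; lra.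
Qed.

(** * The random walk on the torus *)

(** Heuristically, the second variation of [B] dominates [2 |da| |db|]. Together with nonnegativity
    this is all that the dissipation estimates ask of [B]. *)
Definition diagonally_convex (B : R -> R -> R) : Prop :=
  jensen (fun a b => B a b + a * b) /\ jensen (fun a b => B a b - a * b).

Lemma diagonally_convex_jensen (B : R -> R -> R) : diagonally_convex B -> jensen B.
Proof.
intros [H1 H2] T l a b Hl; specialize (H1 T l a b Hl); specialize (H2 T l a b Hl).
cbv beta in H1, H2; rewrite mean_plus in H1; unfold Rminus in H2; rewrite mean_plus in H2.
rewrite (mean_ext l (fun x => - (a x * b x)) (fun x => -1 * (a x * b x))) in H2
  by (intros; ring).
rewrite mean_scal in H2; lra.
Qed.

(** The midpoint defect of the product [a b] is [(a - a') (b - b') / 4]; of the two convexities, one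
    gives it with each sign. *)
Lemma diagonally_convex_midpoint (B : R -> R -> R) (a a' b b' : R) :
  diagonally_convex B ->
  B ((a + a') / 2) ((b + b') / 2)
  <= (B a b + B a' b') / 2 - Rabs (a - a') * Rabs (b - b') / 4.
Proof.
intros [H1 H2].
specialize (H1 bool (true :: false :: nil) (fun s : bool => if s then a else a')
  (fun s : bool => if s then b else b') ltac:(easy)).
specialize (H2 bool (true :: false :: nil) (fun s : bool => if s then a else a')
  (fun s : bool => if s then b else b') ltac:(easy)).
unfold mean in H1, H2; simpl in H1, H2.
replace ((a + (a' + 0)) / (1 + 1)) with ((a + a') / 2) in * by field.
replace ((b + (b' + 0)) / (1 + 1)) with ((b + b') / 2) in * by field.
rewrite <- Rabs_mult; unfold Rabs; destruct (Rcase_abs _); nra.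
Qed.

Lemma mean_list_prod {T} (l : list T) (f : T -> T -> R) :
  l <> nil ->
  mean (list_prod l l) (fun z => f (fst z) (snd z)) = mean l (fun x => mean l (f x)).
Proof.
intros Hl; unfold mean; rewrite Sum_list_prod, length_prod, mult_INR.
rewrite (Sum_ext l (fun x => Sum l (f x) / INR (length l))
  (fun x => / INR (length l) * Sum l (f x))) by (intros; unfold Rdiv; ring).
rewrite Sum_scal; simpl.
change (Sum l (fun x => Sum l (fun y => f x y))) with (Sum l (fun x => Sum l (f x))).
field; pose proof (length_pos l Hl); lra.
Qed.

(** Passes from increments over a common pair to increments over two pairs sharing one point. Either
    [|x' - z'| <= 2 |x' - y'|], or [|x - y| <= 2 |x - z|], or the pair [y], [z] carries at least
    half of both increments; the last case costs the factor [4]. *)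
Lemma product_le_four_max (x y z x' y' z' M : R) :
  Rabs (x - y) * Rabs (x' - y') <= M -> Rabs (x - z) * Rabs (x' - z') <= M ->
  Rabs (y - z) * Rabs (y' - z') <= M ->
  Rabs (x - y) * Rabs (x' - z') <= 4 * M.
Proof.
intros H1 H2 H3.
assert (T1 : Rabs (x - y) <= Rabs (x - z) + Rabs (y - z)).
{ rewrite (Rabs_minus_sym y z); replace (x - y) with ((x - z) + (z - y)) by ring; apply Rabs_triang. }
assert (T2 : Rabs (x' - z') <= Rabs (x' - y') + Rabs (y' - z')).
{ replace (x' - z') with ((x' - y') + (y' - z')) by ring; apply Rabs_triang. }
pose proof (Rabs_pos (x - y)); pose proof (Rabs_pos (x' - y')).
pose proof (Rabs_pos (x - z)); pose proof (Rabs_pos (x' - z')).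
pose proof (Rabs_pos (y - z)); pose proof (Rabs_pos (y' - z')).
assert (Aux : forall a a' b b' c c', 0 <= a -> 0 <= a' -> 0 <= b -> 0 <= b' -> 0 <= c ->
  0 <= c' -> a * a' <= M -> b * b' <= M -> c * c' <= M -> a <= b + c -> b' <= a' + c' ->
  a * b' <= 4 * M).
{ clear; intros a a' b b' c c' Ha Ha' Hb Hb' Hc Hc' H1 H2 H3 T1 T2.
  destruct (Rle_dec b' (2 * a')); [nra|].
  destruct (Rle_dec a (2 * b)); [nra|].
  assert (a * b' <= (2 * c) * (2 * c')) by (apply Rmult_le_compat; lra).
  nra. }
eapply Aux; [| | | | | | exact H1 | exact H2 | exact H3 | |]; assumption.
Qed.

(** A mean over [l] is also the mean of the midpoints of all pairs from [l]. The midpoint inequality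
    followed by Jensen over pairs bounds the average of [|da| |db| / 4] by the gap. One pair among
    [length l ^ 2] gives [4 (length l)^2], and separating the two pairs gives another [4]. *)
Lemma jensen_gap (B : R -> R -> R) {T} (l : list T) (a b : T -> R) (r s t : T) :
  diagonally_convex B -> In r l -> In s l -> In t l ->
  Rabs (a r - a s) * Rabs (b r - b t)
  <= 16 * INR (length l) ^ 2 *
     (mean l (fun x => B (a x) (b x)) - B (mean l a) (mean l b)).
Proof.
intros HB Hr Hs Ht.
assert (Hl : l <> nil) by (intros E; now rewrite E in Hr).
pose proof (length_pos l Hl) as Hm.
set (G := mean l (fun x => B (a x) (b x)) - B (mean l a) (mean l b)).
assert (Hll : list_prod l l <> nil).
{ intros E; assert (H : In (r, r) (list_prod l l)) by now apply in_prod.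
  now rewrite E in H. }
set (q := fun z : T * T =>
  Rabs (a (fst z) - a (snd z)) * Rabs (b (fst z) - b (snd z)) / 4).
assert (Hmid : forall c : T -> R,
  mean (list_prod l l) (fun z => (c (fst z) + c (snd z)) / 2) = mean l c).
{ intros c; rewrite (mean_list_prod l (fun x y => (c x + c y) / 2)) by easy.
  rewrite (mean_ext l _ (fun x => / 2 * c x + / 2 * mean l c)).
  - rewrite mean_plus, mean_scal, mean_const by easy; field.
  - intros x _; rewrite <- (mean_const l (/ 2 * c x)), <- mean_scal, <- mean_plus by easy.
    apply mean_ext; intros; field. }
assert (Hq : mean (list_prod l l) q <= G).
{ pose proof (diagonally_convex_jensen B HB (T * T)%type (list_prod l l)
    (fun z => (a (fst z) + a (snd z)) / 2) (fun z => (b (fst z) + b (snd z)) / 2) Hll) as H.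
  rewrite !Hmid in H.
  assert (H' : mean (list_prod l l) (fun z => B ((a (fst z) + a (snd z)) / 2)
      ((b (fst z) + b (snd z)) / 2) + q z) <= mean l (fun x => B (a x) (b x))).
  { eapply Rle_trans; [apply mean_le; [easy|]|].
    - intros z _; pose proof (diagonally_convex_midpoint B (a (fst z)) (a (snd z))
        (b (fst z)) (b (snd z)) HB) as Hz.
      apply Rplus_le_compat_r with (r := q z) in Hz.
      eapply Rle_trans; [exact Hz|]; unfold q.
      instantiate (1 := fun z => (B (a (fst z)) (b (fst z)) + B (a (snd z)) (b (snd z))) / 2).
      simpl; lra.
    - right; apply (Hmid (fun x => B (a x) (b x))). }
  rewrite mean_plus in H'; unfold G; lra. }
assert (Hterm : forall x y, In x l -> In y l ->
  Rabs (a x - a y) * Rabs (b x - b y) <= 4 * INR (length l) ^ 2 * G).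
{ intros x y Hx Hy.
  assert (H : q (x, y) <= Sum (list_prod l l) q).
  { apply Sum_ge_term; [|now apply in_prod].
    intros z _; unfold q; pose proof (Rabs_pos (a (fst z) - a (snd z)));
      pose proof (Rabs_pos (b (fst z) - b (snd z))); nra. }
  unfold mean in Hq; rewrite length_prod, mult_INR in Hq.
  apply Rmult_le_compat_r with (r := INR (length l) * INR (length l)) in Hq; [|nra].
  unfold Rdiv in Hq; rewrite Rmult_assoc, Rinv_l, Rmult_1_r in Hq by nra.
  unfold q in H at 1; simpl in H; nra. }
replace (16 * INR (length l) ^ 2 * G) with (4 * (4 * INR (length l) ^ 2 * G)) by ring.
apply product_le_four_max with (z := a t) (y' := b s); now apply Hterm.
Qed.

(** The Bellman function of the Hilbert space case: [quadratic a b] plus or minus [a b] is half a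
    square. It yields the energy estimates from the same dissipation lemma. *)
Definition quadratic (a b : R) : R := (a * a + b * b) / 2.

Lemma subdifferentiable_square : subdifferentiable (fun t => t * t / 2).
Proof. intros t0; exists t0; intros t; pose proof (Rle_0_sqr (t - t0)); unfold Rsqr in *; lra. Qed.

Lemma diagonally_convex_quadratic : diagonally_convex quadratic.
Proof.
split; intros T l a b Hl; unfold quadratic.
- pose proof (subdifferentiable_jensen _ l (fun x => a x + b x) subdifferentiable_square Hl) as H.
  simpl in H; rewrite mean_plus in H.
  rewrite (mean_ext l (fun s => (a s * a s + b s * b s) / 2 + a s * b s)
    (fun s => (a s + b s) * (a s + b s) / 2)) by (intros; field); lra.
- pose proof (subdifferentiable_jensen _ l (fun x => a x + -1 * b x) subdifferentiable_square Hl) as H.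
  simpl in H; rewrite mean_plus, mean_scal in H.
  rewrite (mean_ext l (fun s => (a s * a s + b s * b s) / 2 - a s * b s)
    (fun s => (a s + -1 * b s) * (a s + -1 * b s) / 2)) by (intros; field); lra.
Qed.

(** * Translations, periodic functions and summation by parts *)

Lemma upd_0 (x : point) (i : nat) : upd x i 0 = x.
Proof.
revert i; induction x as [|a x IH]; intros [|i]; simpl; try easy;
  [now rewrite Z.add_0_r | now rewrite IH].
Qed.

Lemma upd_upd (x : point) (i : nat) (k l : Z) : upd (upd x i k) i l = upd x i (k + l).
Proof.
revert i; induction x as [|a x IH]; intros [|i]; simpl; try easy;
  [now rewrite Z.add_assoc | now rewrite IH].
Qed.

Lemma upd_comm (x : point) (i j : nat) (k l : Z) :
  upd (upd x i k) j l = upd (upd x j l) i k.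
Proof.
revert i j; induction x as [|a x IH]; intros [|i] [|j]; simpl; try easy;
  [f_equal; lia | now rewrite IH].
Qed.

(** The torus has no type of its own: its functions are the periodic ones, summed over [box d N]. *)
Definition periodic (N : nat) (f : point -> R) : Prop :=
  forall x i, f (upd x i (Z.of_nat N)) = f x.

Lemma periodic_upd (N : nat) (f : point -> R) (i : nat) (k : Z) :
  periodic N f -> periodic N (fun x => f (upd x i k)).
Proof. intros H x j; rewrite upd_comm; apply H. Qed.

Lemma periodic_op2 (N : nat) (op : R -> R -> R) (f g : point -> R) :
  periodic N f -> periodic N g -> periodic N (fun x => op (f x) (g x)).
Proof. intros Hf Hg x i; now rewrite Hf, Hg. Qed.

Lemma Sum_shift_periodic (N : nat) (h : Z -> R) :
  (forall z, h (z + Z.of_nat N)%Z = h z) ->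
  Sum (seq 0 N) (fun k => h (Z.of_nat k + 1)%Z) = Sum (seq 0 N) (fun k => h (Z.of_nat k)).
Proof.
intros Hh.
assert (H : forall n, Sum (seq 0 n) (fun k => h (Z.of_nat k + 1)%Z) + h 0%Z
  = Sum (seq 0 n) (fun k => h (Z.of_nat k)) + h (Z.of_nat n)).
{ induction n as [|n IH]; [easy|].
  rewrite seq_S, !Sum_app; simpl lsum at 2 4.
  replace (Z.of_nat (S n)) with (Z.of_nat n + 1)%Z by lia.
  simpl; lra. }
specialize (H N); specialize (Hh 0%Z); simpl in Hh; lra.
Qed.

Lemma Sum_box_S (d N : nat) (f : point -> R) :
  Sum (box (S d) N) f
  = Sum (seq 0 N) (fun k => Sum (box d N) (fun x => f (Z.of_nat k :: x))).
Proof.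
simpl box; rewrite Sum_flat_map, Sum_map; apply Sum_ext; intros; now rewrite Sum_map.
Qed.

Lemma Sum_box_upd_1 (d N i : nat) (f : point -> R) :
  periodic N f -> Sum (box d N) (fun x => f (upd x i 1)) = Sum (box d N) f.
Proof.
revert i f; induction d as [|d IH]; intros i f Hf.
- simpl; now destruct i.
- rewrite !Sum_box_S; destruct i as [|i]; simpl.
  + rewrite Sum_swap, (Sum_swap (seq 0 N)); apply Sum_ext; intros x _.
    apply (Sum_shift_periodic N (fun z => f (z :: x))).
    intros z; apply (Hf (z :: x) O).
  + apply Sum_ext; intros k _.
    apply (IH i (fun x => f (Z.of_nat k :: x))).
    intros x j; apply (Hf (Z.of_nat k :: x) (S j)).
Qed.

Lemma Sum_box_upd_m1 (d N i : nat) (f : point -> R) :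
  periodic N f -> Sum (box d N) (fun x => f (upd x i (-1))) = Sum (box d N) f.
Proof.
intros Hf; rewrite <- (Sum_box_upd_1 d N i (fun x => f (upd x i (-1))))
  by now apply periodic_upd.
apply Sum_ext; intros x _; now rewrite upd_upd, upd_0.
Qed.

Lemma Sum_box_by_parts (d N i : nat) (f g : point -> R) :
  periodic N f -> periodic N g ->
  Sum (box d N) (fun x => f (upd x i 1) * g x)
  = Sum (box d N) (fun x => f x * g (upd x i (-1))).
Proof.
intros Hf Hg.
rewrite <- (Sum_box_upd_1 d N i (fun x => f x * g (upd x i (-1)))).
- apply Sum_ext; intros x _; now rewrite upd_upd, upd_0.
- apply (periodic_op2 N Rmult); [easy | now apply periodic_upd].
Qed.

(** Steps are kept as translations instead of target points, so the walk commutes with shifts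
    through [upd_comm]. The identity makes the walk lazy and provides the point shared by two
    differences in distinct directions. *)
Definition neighbourhood (d : nat) : list (point -> point) :=
  (fun x => x) ::
  flat_map (fun i => (fun x => upd x i 1) :: (fun x => upd x i (-1)) :: nil) (seq 0 d).

Lemma neighbourhood_length (d : nat) : INR (length (neighbourhood d)) = 2 * INR d + 1.
Proof.
unfold neighbourhood; simpl length; rewrite S_INR; f_equal.
rewrite <- (Rmult_1_r (INR (length _))), <- Sum_const, Sum_flat_map.
rewrite (Sum_ext _ _ (fun _ => 2)) by (intros; simpl; ring).
rewrite Sum_const, length_seq; ring.
Qed.

Lemma in_neighbourhood (d : nat) (s : point -> point) :
  In s (neighbourhood d) ->
  exists i k, (k = 0 \/ k = 1 \/ k = -1)%Z /\ s = fun x => upd x i k.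
Proof.
intros [<-|H].
- exists O, 0%Z; split; [auto|]; apply functional_extensionality; intros x; now rewrite upd_0.
- apply in_flat_map in H; destruct H as (i & _ & [<-|[<-|[]]]).
  + now exists i, 1%Z; split; [auto|].
  + now exists i, (-1)%Z; split; [auto|].
Qed.

Definition walk (d : nat) (f : point -> R) : point -> R :=
  fun x => mean (neighbourhood d) (fun s => f (s x)).

Lemma walk_formula (d : nat) (f : point -> R) (x : point) :
  (2 * INR d + 1) * walk d f x
  = f x + Sum (seq 0 d) (fun i => f (upd x i 1) + f (upd x i (-1))).
Proof.
unfold walk, mean; rewrite neighbourhood_length.
unfold neighbourhood; simpl map; simpl lsum; rewrite Sum_flat_map.
pose proof (pos_INR d).
rewrite (Sum_ext (seq 0 d) (fun i => f (upd x i 1) + f (upd x i (-1)))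
 (fun i => f (upd x i 1) + (f (upd x i (-1)) + 0))) by (intros; ring).
simpl; field; lra.
Qed.

Lemma walk_lap (d : nat) (f : point -> R) (x : point) :
  f x - walk d f x = / (2 * INR d + 1) * - lap d f x.
Proof.
pose proof (pos_INR d).
apply Rmult_eq_reg_l with (2 * INR d + 1); [|lra].
rewrite <- Rmult_assoc, Rinv_r, Rmult_1_l, Rmult_minus_distr_l, walk_formula by lra.
unfold lap, div, sum_dir, grad.
rewrite (Sum_ext _ (fun i => f (upd x i 1) - f x - _)
  (fun i => (f (upd x i 1) + f (upd x i (-1))) - 2 * f x)).
- rewrite Sum_minus, Sum_const, length_seq; ring.
- intros i _; rewrite upd_upd, upd_0; ring.
Qed.

Lemma walk_periodic (d N : nat) (f : point -> R) : periodic N f -> periodic N (walk d f).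
Proof.
intros Hf x i; unfold walk; apply mean_ext; intros s Hs.
apply in_neighbourhood in Hs; destruct Hs as (j & k & _ & ->); rewrite upd_comm; apply Hf.
Qed.

Lemma walk_upd (d i : nat) (k : Z) (f : point -> R) :
  walk d (fun x => f (upd x i k)) = fun x => walk d f (upd x i k).
Proof.
apply functional_extensionality; intros x; unfold walk; apply mean_ext; intros s Hs.
apply in_neighbourhood in Hs; destruct Hs as (j & l & _ & ->); now rewrite upd_comm.
Qed.

Lemma walk_plus (d : nat) (f g : point -> R) :
  walk d (fun x => f x + g x) = fun x => walk d f x + walk d g x.
Proof. apply functional_extensionality; intros x; unfold walk; now rewrite mean_plus. Qed.

Lemma walk_scal (d : nat) (k : R) (f : point -> R) :
  walk d (fun x => k * f x) = fun x => k * walk d f x.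
Proof. apply functional_extensionality; intros x; unfold walk; now rewrite mean_scal. Qed.

Lemma walk_minus (d : nat) (f g : point -> R) :
  walk d (fun x => f x - g x) = fun x => walk d f x - walk d g x.
Proof.
replace (fun x => f x - g x) with (fun x => f x + -1 * g x)
  by (apply functional_extensionality; intros; ring).
rewrite walk_plus, walk_scal; apply functional_extensionality; intros; ring.
Qed.

Lemma walk_Sum {T} (d : nat) (l : list T) (f : T -> point -> R) :
  walk d (fun x => Sum l (fun k => f k x)) = fun x => Sum l (fun k => walk d (f k) x).
Proof.
induction l as [|a l IH]; simpl.
- apply functional_extensionality; intros x; unfold walk; now rewrite mean_const.
- now rewrite (walk_plus d (f a)), IH.
Qed.

Lemma Sum_box_walk (d N : nat) (f : point -> R) :
  periodic N f -> Sum (box d N) (walk d f) = Sum (box d N) f.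
Proof.
intros Hf; unfold walk, mean.
rewrite (Sum_ext _ _ (fun x => / INR (length (neighbourhood d))
  * Sum (neighbourhood d) (fun s => f (s x)))) by (intros; unfold Rdiv; ring).
rewrite Sum_scal, Sum_swap, (Sum_ext (neighbourhood d) _ (fun _ => Sum (box d N) f)).
- rewrite Sum_const; field; rewrite neighbourhood_length; pose proof (pos_INR d); lra.
- intros s Hs; apply in_neighbourhood in Hs; destruct Hs as (i & k & [->|[->| ->]] & ->).
  + apply Sum_ext; intros x _; now rewrite upd_0.
  + now apply Sum_box_upd_1.
  + now apply Sum_box_upd_m1.
Qed.

Lemma walk_selfadjoint (d N : nat) (f g : point -> R) :
  periodic N f -> periodic N g ->
  Sum (box d N) (fun x => walk d f x * g x) = Sum (box d N) (fun x => f x * walk d g x).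
Proof.
intros Hf Hg; pose proof (pos_INR d).
apply Rmult_eq_reg_l with (2 * INR d + 1); [|lra].
rewrite <- !Sum_scal.
rewrite (Sum_ext _ (fun x => (2 * INR d + 1) * (walk d f x * g x)) (fun x => f x * g x
  + Sum (seq 0 d) (fun i => f (upd x i 1) * g x + f (upd x i (-1)) * g x))).
2:{ intros x _; rewrite <- Rmult_assoc, walk_formula, Rmult_plus_distr_r; f_equal.
    rewrite Rmult_comm, <- Sum_scal; apply Sum_ext; intros; ring. }
rewrite (Sum_ext _ (fun x => (2 * INR d + 1) * (f x * walk d g x)) (fun x => f x * g x
  + Sum (seq 0 d) (fun i => f x * g (upd x i 1) + f x * g (upd x i (-1))))).
2:{ intros x _; replace ((2 * INR d + 1) * (f x * walk d g x))
      with (f x * ((2 * INR d + 1) * walk d g x)) by ring.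
    rewrite walk_formula, Rmult_plus_distr_l; f_equal.
    rewrite <- Sum_scal; apply Sum_ext; intros; ring. }
rewrite !Sum_plus; f_equal; rewrite Sum_swap, (Sum_swap (box d N)).
apply Sum_ext; intros i _; rewrite !Sum_plus, Sum_box_by_parts by easy.
rewrite (Sum_ext _ (fun x => f (upd x i (-1)) * g x) (fun x => g x * f (upd x i (-1))))
  by (intros; ring).
rewrite <- (Sum_box_by_parts d N i g f) by easy.
rewrite (Sum_ext _ (fun x => g (upd x i 1) * f x) (fun x => f x * g (upd x i 1)))
  by (intros; ring); ring.
Qed.

Definition iter_walk (d n : nat) : (point -> R) -> point -> R := Nat.iter n (walk d).

Lemma iter_walk_periodic (d N n : nat) (f : point -> R) :
  periodic N f -> periodic N (iter_walk d n f).
Proof. intros Hf; induction n as [|n IH]; [easy | now apply walk_periodic]. Qed.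

Definition bdiff (i : nat) (f : point -> R) : point -> R := fun x => f x - f (upd x i (-1)).

Lemma bdiff_periodic (N i : nat) (f : point -> R) : periodic N f -> periodic N (bdiff i f).
Proof. intros Hf; apply (periodic_op2 N Rminus); [easy | now apply periodic_upd]. Qed.

Lemma walk_bdiff (d i : nat) (f : point -> R) : walk d (bdiff i f) = bdiff i (walk d f).
Proof. unfold bdiff; now rewrite walk_minus, walk_upd. Qed.

Lemma iter_walk_bdiff (d n i : nat) (f : point -> R) :
  iter_walk d n (bdiff i f) = bdiff i (iter_walk d n f).
Proof. induction n as [|n IH]; [easy|]; simpl; now rewrite IH, walk_bdiff. Qed.

Lemma iter_walk_walk (d n : nat) (f : point -> R) :
  iter_walk d n (walk d f) = walk d (iter_walk d n f).
Proof. induction n as [|n IH]; [easy|]; simpl; now rewrite IH. Qed.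

Lemma iter_walk_minus (d n : nat) (f g : point -> R) :
  iter_walk d n (fun x => f x - g x) = fun x => iter_walk d n f x - iter_walk d n g x.
Proof. induction n as [|n IH]; [easy|]; simpl; now rewrite IH, walk_minus. Qed.

Lemma iter_walk_scal (d n : nat) (k : R) (f : point -> R) :
  iter_walk d n (fun x => k * f x) = fun x => k * iter_walk d n f x.
Proof. induction n as [|n IH]; [easy|]; simpl; now rewrite IH, walk_scal. Qed.

Lemma iter_walk_Sum {T} (d n : nat) (l : list T) (f : T -> point -> R) :
  iter_walk d n (fun x => Sum l (fun k => f k x))
  = fun x => Sum l (fun k => iter_walk d n (f k) x).
Proof. induction n as [|n IH]; [easy|]; simpl; now rewrite IH, walk_Sum. Qed.

(** * Dissipation of [B] along the walk, and decay of the pairing *)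

Section Dissipation.

Variables (d N : nat) (B : R -> R -> R).
Hypothesis HB0 : forall a b, 0 <= B a b.
Hypothesis HB : diagonally_convex B.

Let K := 16 * (2 * INR d + 1) ^ 2.

(** The Jensen gap at three steps of the walk: staying, and moving back in directions [i] and
    [j]. *)
Lemma walk_dissipation_pointwise (a b : point -> R) (i j : nat) (x : point) :
  (i < d)%nat -> (j < d)%nat ->
  Rabs (bdiff i a x) * Rabs (bdiff j b x)
  <= K * (walk d (fun x => B (a x) (b x)) x - B (walk d a x) (walk d b x)).
Proof.
intros Hi Hj.
assert (Hin : forall i, (i < d)%nat -> In (fun x => upd x i (-1)) (neighbourhood d)).
{ intros k Hk; right; apply in_flat_map; exists k; split; [apply in_seq; lia|].
  right; now left. }
pose proof (jensen_gap B (neighbourhood d) (fun s => a (s x)) (fun s => b (s x))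
  (fun x => x) _ _ HB ltac:(now left) (Hin i Hi) (Hin j Hj)) as H.
now rewrite neighbourhood_length in H.
Qed.

(** The walk preserves sums over the torus, so the summed gap is a difference of two consecutive
    totals of [B], ready to telescope. *)
Lemma walk_dissipation (a b : point -> R) (i j : nat) :
  periodic N a -> periodic N b -> (i < d)%nat -> (j < d)%nat ->
  Sum (box d N) (fun x => Rabs (bdiff i a x) * Rabs (bdiff j b x))
  <= K * (Sum (box d N) (fun x => B (a x) (b x))
          - Sum (box d N) (fun x => B (walk d a x) (walk d b x))).
Proof.
intros Ha Hb Hi Hj.
eapply Rle_trans; [apply Sum_le; intros x _; now apply walk_dissipation_pointwise|].
rewrite Sum_scal, Sum_minus, (Sum_box_walk d N (fun x => B (a x) (b x)));
  [lra | now apply periodic_op2].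
Qed.

Lemma iter_walk_dissipation (a b : point -> R) (i j n : nat) :
  periodic N a -> periodic N b -> (i < d)%nat -> (j < d)%nat ->
  Sum (seq 0 n) (fun k => Sum (box d N) (fun x =>
    Rabs (bdiff i (iter_walk d k a) x) * Rabs (bdiff j (iter_walk d k b) x)))
  <= K * Sum (box d N) (fun x => B (a x) (b x)).
Proof.
intros Ha Hb Hi Hj.
assert (HK : 0 <= K) by (unfold K; pose proof (pow2_ge_0 (2 * INR d + 1)); lra).
assert (H : Sum (seq 0 n) (fun k => Sum (box d N) (fun x =>
    Rabs (bdiff i (iter_walk d k a) x) * Rabs (bdiff j (iter_walk d k b) x)))
  + K * Sum (box d N) (fun x => B (iter_walk d n a x) (iter_walk d n b x))
  <= K * Sum (box d N) (fun x => B (a x) (b x))).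
{ induction n as [|n IH]; [simpl; lra|].
  rewrite seq_S, Sum_app.
  pose proof (walk_dissipation (iter_walk d n a) (iter_walk d n b) i j
    (iter_walk_periodic d N n a Ha) (iter_walk_periodic d N n b Hb) Hi Hj) as H.
  simpl in *; lra. }
assert (0 <= K * Sum (box d N) (fun x => B (iter_walk d n a x) (iter_walk d n b x))).
{ apply Rmult_le_pos; [easy | apply Sum_nonneg; intros; apply HB0]. }
lra.
Qed.

End Dissipation.

Lemma quadratic_nonneg (a b : R) : 0 <= quadratic a b.
Proof. unfold quadratic; nra. Qed.

(** On the diagonal [a = b] the function [quadratic] is the square, so Jensen makes the walk a
    contraction of the energy. *)
Lemma iter_walk_energy_le (d N n : nat) (f : point -> R) :
  periodic N f ->
  Sum (box d N) (fun x => iter_walk d n f x ^ 2) <= Sum (box d N) (fun x => f x ^ 2).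
Proof.
intros Hf; induction n as [|n IH]; [simpl; lra|].
eapply Rle_trans; [|exact IH].
rewrite <- (Sum_box_walk d N (fun x => iter_walk d n f x ^ 2)).
- apply Sum_le; intros x _.
  pose proof (diagonally_convex_jensen _ diagonally_convex_quadratic _ (neighbourhood d)
    (fun s => iter_walk d n f (s x)) (fun s => iter_walk d n f (s x)) ltac:(easy)) as H.
  unfold quadratic in H.
  rewrite (mean_ext _ (fun s => (iter_walk d n f (s x) * iter_walk d n f (s x)
    + iter_walk d n f (s x) * iter_walk d n f (s x)) / 2)
    (fun s => iter_walk d n f (s x) ^ 2)) in H by (intros; field).
  change (walk d (iter_walk d n f) x ^ 2 <= walk d (fun x => iter_walk d n f x ^ 2) x).
  change (mean (neighbourhood d) (fun s => iter_walk d n f (s x)))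
    with (walk d (iter_walk d n f) x) in H.
  unfold walk at 2; lra.
- assert (H := iter_walk_periodic d N n f Hf); intros x i; now rewrite H.
Qed.

(** The squared differences summed over all times stay below the fixed number [E], so among more
    than [E / e] times one has a value at most [e]. *)
Lemma iter_walk_gradient_small (d N j : nat) (f : point -> R) (e : R) :
  periodic N f -> (j < d)%nat -> 0 < e ->
  exists n, Sum (box d N) (fun x => bdiff j (iter_walk d n f) x ^ 2) <= e.
Proof.
intros Hf Hj He.
set (E := 16 * (2 * INR d + 1) ^ 2 * Sum (box d N) (fun x => quadratic (f x) (f x))).
destruct (archimed (E / e)) as [Hn _].
set (n := Z.to_nat (up (E / e))).
assert (Hn' : E < INR n * e).
{ assert (E / e < INR n).
  { apply Rlt_le_trans with (IZR (up (E / e))); [lra|].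
    rewrite INR_IZR_INZ; apply IZR_le; unfold n; lia. }
  apply Rmult_lt_compat_r with (r := e) in H; [|easy].
  unfold Rdiv in H; rewrite Rmult_assoc, Rinv_l, Rmult_1_r in H by lra; easy. }
pose proof (iter_walk_dissipation d N quadratic quadratic_nonneg diagonally_convex_quadratic
  f f j j n Hf Hf Hj Hj) as H; fold E in H.
(* Induction on [m]: either a good time has been met, or each of the first [m] times has contributed
   more than [e]. *)
assert (D : forall m,
  (exists k, Sum (box d N) (fun x => bdiff j (iter_walk d k f) x ^ 2) <= e) \/
  INR m * e <= Sum (seq 0 m) (fun k => Sum (box d N) (fun x =>
    Rabs (bdiff j (iter_walk d k f) x) * Rabs (bdiff j (iter_walk d k f) x)))).
{ induction m as [|m [IH|IH]]; [right; simpl; lra | now left|].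
  destruct (Rle_dec (Sum (box d N) (fun x => bdiff j (iter_walk d m f) x ^ 2)) e) as [Hm|Hm];
    [left; now exists m|right].
  match goal with |- _ <= Sum _ ?h => set (dissip := h) in * end.
  assert (Em : dissip m = Sum (box d N) (fun x => bdiff j (iter_walk d m f) x ^ 2)).
  { apply Sum_ext; intros x _; rewrite <- Rabs_mult, Rabs_pos_eq by nra; ring. }
  rewrite seq_S, Sum_app, S_INR.
  change (Sum ((0 + m)%nat :: nil) dissip) with (dissip m + 0); lra. }
destruct (D n) as [HD|HD]; [easy | lra].
Qed.

(** Summation by parts moves the difference to [u], whose gradient is small at some time, while the
    energy of [g] never grows. *)
Lemma iter_walk_pairing_small (d N j : nat) (u g : point -> R) (e : R) :
  periodic N u -> periodic N g -> (j < d)%nat -> 0 < e ->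
  exists n, Rabs (Sum (box d N) (fun x =>
    iter_walk d n u x * bdiff j (iter_walk d n g) x)) <= e.
Proof.
intros Hu Hg Hj He.
set (G := Sum (box d N) (fun x => g x ^ 2)).
assert (HG : 0 <= G) by (apply Sum_nonneg; intros; apply pow2_ge_0).
(* The weight in the arithmetic-geometric inequality. With gradient tolerance [r e] one half
   contributes [e / 2] and the other [r G / 2 <= e / 2]; [G + 1] keeps the division safe when [g]
   vanishes. *)
set (r := e / (G + 1)).
assert (Hr : 0 < r) by (apply Rdiv_lt_0_compat; lra).
assert (Hr' : r * (G + 1) = e) by (unfold r; field; lra).
destruct (iter_walk_gradient_small d N j u (r * e) Hu Hj ltac:(nra)) as [n Hn].
exists n.
pose proof (iter_walk_energy_le d N n g Hg) as HE; fold G in HE.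
pose proof (iter_walk_periodic d N n u Hu) as Hun.
pose proof (iter_walk_periodic d N n g Hg) as Hgn.
set (v := iter_walk d n u) in *; set (h := iter_walk d n g) in *.
assert (Ev : Sum (box d N) (fun x => v x * bdiff j h x)
  = Sum (box d N) (fun x => - (bdiff j v x * h (upd x j (-1))))).
{ unfold bdiff.
  rewrite (Sum_ext _ (fun x => v x * _) (fun x => v x * h x - v x * h (upd x j (-1))))
    by (intros; ring).
  rewrite (Sum_ext _ (fun x => - _) (fun x => v (upd x j (-1)) * h (upd x j (-1))
    - v x * h (upd x j (-1)))) by (intros; ring).
  rewrite !Sum_minus; f_equal.
  symmetry; apply (Sum_box_upd_m1 d N j (fun x => v x * h x)); now apply (periodic_op2 N Rmult). }
rewrite Ev; eapply Rle_trans; [apply Sum_Rabs|].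
apply Rle_trans with (Sum (box d N) (fun x => / (2 * r) * bdiff j v x ^ 2
  + r / 2 * h (upd x j (-1)) ^ 2)).
- apply Sum_le; intros x _; rewrite Rabs_Ropp, Rabs_mult.
  rewrite <- (pow2_abs (bdiff j v x)), <- (pow2_abs (h _)).
  generalize (Rabs (bdiff j v x)), (Rabs (h (upd x j (-1)))); intros s t.
  apply Rmult_le_reg_l with (2 * r); [lra|].
  replace (2 * r * (/ (2 * r) * s ^ 2 + r / 2 * t ^ 2)) with (s ^ 2 + (r * t) ^ 2)
    by (field; lra).
  pose proof (pow2_ge_0 (s - r * t)); lra.
- rewrite Sum_plus, !Sum_scal.
  rewrite (Sum_box_upd_m1 d N j (fun x => h x ^ 2)) by (intros x i; now rewrite Hgn).
  apply Rle_trans with (/ (2 * r) * (r * e) + r / 2 * G).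
  + apply Rplus_le_compat; apply Rmult_le_compat_l; try easy; [|lra].
    left; apply Rinv_0_lt_compat; lra.
  + replace (/ (2 * r) * (r * e)) with (e / 2) by (field; lra); lra.
Qed.

(** After telescoping only the initial total of [B] survives. The constant is the Jensen gap
    constant [16 m^2] divided by the normalisation [m = 2d + 1] of the walk. *)
Lemma torus_bilinear_estimate (d N j : nat) (B : R -> R -> R)
  (F : point -> nat -> R) (u g : point -> R) :
  (forall a b, 0 <= B a b) -> diagonally_convex B ->
  periodic N u -> periodic N g -> (forall i, periodic N (fun x => F x i)) ->
  (forall x, - lap d u x = div d F x) -> (j < d)%nat ->
  Rabs (Sum (box d N) (fun x => grad u x j * g x))
  <= 16 * (2 * INR d + 1) * Sum (seq 0 d) (fun i => Sum (box d N) (fun x =>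
       B (F x i + walk d (fun y => F y i) x) (g x))).
Proof.
intros HB0 HB Hu Hg HF Heq Hj.
pose proof (pos_INR d) as Hd.
set (m := 2 * INR d + 1) in *.
assert (Hm : 0 < m) by (unfold m; lra).
set (H := fun i x => F x i + walk d (fun y => F y i) x).
assert (HH : forall i, periodic N (H i)).
{ intros i; apply (periodic_op2 N Rplus); [apply HF | apply walk_periodic, HF]. }
set (A := fun n => Sum (box d N) (fun x => iter_walk d n u x * bdiff j (iter_walk d n g) x)).
assert (Ew : (fun x => u x - walk d u x)
  = fun x => / m * Sum (seq 0 d) (fun i => bdiff i (fun y => F y i) x)).
{ apply functional_extensionality; intros x; rewrite walk_lap, Heq; reflexivity. }
(* Here [u - P P u] is split as [(u - P u) + P (u - P u)], and the equation is applied to each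
   half. *)
assert (Eww : (fun x => u x - walk d (walk d u) x)
  = fun x => / m * Sum (seq 0 d) (fun i => bdiff i (H i) x)).
{ apply functional_extensionality; intros x.
  replace (u x - walk d (walk d u) x)
    with ((fun x => u x - walk d u x) x + walk d (fun x => u x - walk d u x) x)
    by (rewrite walk_minus; ring).
  pose proof (equal_f Ew x) as Ex; cbv beta in Ex.
  rewrite Ew, walk_scal; cbv beta; rewrite Ex, <- Rmult_plus_distr_l; f_equal.
  rewrite (walk_Sum d (seq 0 d) (fun i => bdiff i (fun y => F y i))), <- Sum_plus.
  apply Sum_ext; intros i _; rewrite walk_bdiff; unfold bdiff, H; ring. }
(* In [A (S n)] the walk acting on [g_n] passes through the difference and, by self-adjointness,
   over to [u_n]. *)
assert (Step : forall n, A n - A (S n) = / m * Sum (seq 0 d) (fun i => Sum (box d N) (fun x =>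
  bdiff i (iter_walk d n (H i)) x * bdiff j (iter_walk d n g) x))).
{ intros n; unfold A; simpl.
  rewrite <- (walk_bdiff d j (iter_walk d n g)).
  rewrite <- walk_selfadjoint.
  2: now apply walk_periodic, iter_walk_periodic.
  2: now apply bdiff_periodic, iter_walk_periodic.
  rewrite <- !iter_walk_walk, <- Sum_minus, Sum_swap, <- Sum_scal.
  apply Sum_ext; intros x _.
  rewrite <- Rmult_minus_distr_r.
  change (iter_walk d n u x - iter_walk d n (walk d (walk d u)) x)
    with ((fun x => iter_walk d n u x - iter_walk d n (walk d (walk d u)) x) x).
  rewrite <- iter_walk_minus, Eww, iter_walk_scal.
  rewrite (iter_walk_Sum d n (seq 0 d) (fun i => bdiff i (H i))).
  rewrite Rmult_assoc; f_equal; rewrite Rmult_comm, <- Sum_scal.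
  apply Sum_ext; intros i _; rewrite iter_walk_bdiff; ring. }
set (Q := 16 * m * Sum (seq 0 d) (fun i => Sum (box d N) (fun x => B (H i x) (g x)))).
assert (Tele : forall n, Rabs (A O) <= Rabs (A n) + / m * Sum (seq 0 d) (fun i =>
  Sum (seq 0 n) (fun k => Sum (box d N) (fun x =>
  Rabs (bdiff i (iter_walk d k (H i)) x) * Rabs (bdiff j (iter_walk d k g) x))))).
{ induction n as [|n IH].
  - simpl map; rewrite Sum_zero by easy; lra.
  - eapply Rle_trans; [exact IH|].
    rewrite (Sum_ext (seq 0 d) (fun i => Sum (seq 0 (S n)) _) (fun i =>
      Sum (seq 0 n) (fun k => Sum (box d N) (fun x =>
        Rabs (bdiff i (iter_walk d k (H i)) x) * Rabs (bdiff j (iter_walk d k g) x)))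
      + Sum (box d N) (fun x =>
        Rabs (bdiff i (iter_walk d n (H i)) x) * Rabs (bdiff j (iter_walk d n g) x))))
      by (intros i _; rewrite seq_S, Sum_app; simpl; ring).
    rewrite Sum_plus, Rmult_plus_distr_l.
    assert (Rabs (A n - A (S n)) <= / m * Sum (seq 0 d) (fun i => Sum (box d N) (fun x =>
      Rabs (bdiff i (iter_walk d n (H i)) x) * Rabs (bdiff j (iter_walk d n g) x)))).
    { rewrite Step, Rabs_mult, (Rabs_pos_eq (/ m)) by (left; now apply Rinv_0_lt_compat).
      apply Rmult_le_compat_l; [left; now apply Rinv_0_lt_compat|].
      eapply Rle_trans; [apply Sum_Rabs|]; apply Sum_le; intros i _.
      eapply Rle_trans; [apply Sum_Rabs|]; apply Sum_le; intros x _.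
      now rewrite Rabs_mult; right. }
    assert (Rabs (A n) <= Rabs (A (S n)) + Rabs (A n - A (S n))).
    { replace (A n) with (A (S n) + (A n - A (S n))) at 1 by ring; apply Rabs_triang. }
    lra. }
assert (Bound : forall n, Rabs (A O) <= Rabs (A n) + Q).
{ intros n; eapply Rle_trans; [apply (Tele n)|]; apply Rplus_le_compat_l.
  unfold Q.
  apply Rle_trans with (/ m * Sum (seq 0 d) (fun i => 16 * m ^ 2 *
    Sum (box d N) (fun x => B (H i x) (g x)))).
  - apply Rmult_le_compat_l; [left; now apply Rinv_0_lt_compat|].
    apply Sum_le; intros i Hi; apply in_seq in Hi.
    apply (iter_walk_dissipation d N B HB0 HB (H i) g i j n); auto; lia.
  - rewrite Sum_scal; right; field; lra. }
(* The forward difference of [u] is minus the adjoint of the backward difference of [g]; the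
   absolute value removes the sign. *)
assert (A0 : Rabs (Sum (box d N) (fun x => grad u x j * g x)) = Rabs (A O)).
{ rewrite <- Rabs_Ropp; f_equal; unfold A; simpl; unfold grad, bdiff.
  rewrite (Sum_ext _ (fun x => (_ - _) * _) (fun x => u (upd x j 1) * g x - u x * g x))
    by (intros; ring).
  rewrite (Sum_ext _ (fun x => u x * (_ - _)) (fun x => u x * g x - u x * g (upd x j (-1))))
    by (intros; ring).
  rewrite !Sum_minus, Sum_box_by_parts by easy; ring. }
rewrite A0; change (Rabs (A O) <= Q).
(* The time [n] depends on [e] and on the torus, while [Q] does not depend on [n]. *)
apply le_epsilon; intros e He.
destruct (iter_walk_pairing_small d N j u g e Hu Hg Hj He) as [n Hn].
specialize (Bound n); fold (A n) in Hn; lra.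
Qed.

(** * Reflection of the box *)

(** Assignment of a coordinate, where [upd] translates it. With the other coordinates frozen, a
    function along direction [i] becomes a function of one integer, and reflection is a
    one-dimensional question. *)
Fixpoint set_coord (x : point) (i : nat) (z : Z) : point :=
  match x, i with
  | nil, _ => nil
  | a :: t, O => z :: t
  | a :: t, S j => a :: set_coord t j z
  end.

Notation coord x i := (nth i x 0%Z).

Lemma upd_set_coord (x : point) (i : nat) (k : Z) : upd x i k = set_coord x i (coord x i + k).
Proof.
revert i; induction x as [|a x IH]; intros [|i]; simpl; try easy; now rewrite IH.
Qed.

Lemma length_set_coord (x : point) (i : nat) (z : Z) : length (set_coord x i z) = length x.
Proof. revert i; induction x as [|a x IH]; intros [|i]; simpl; auto. Qed.

Lemma coord_set_coord_eq (x : point) (i : nat) (z : Z) :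
  (i < length x)%nat -> coord (set_coord x i z) i = z.
Proof.
revert i; induction x as [|a x IH]; intros [|i] H; simpl in *; try lia; auto.
apply IH; lia.
Qed.

Lemma coord_set_coord_neq (x : point) (i k : nat) (z : Z) :
  i <> k -> coord (set_coord x i z) k = coord x k.
Proof.
revert i k; induction x as [|a x IH]; intros [|i] [|k] H; simpl; try easy.
apply IH; lia.
Qed.

Lemma set_coord_twice (x : point) (i : nat) (a b : Z) :
  set_coord (set_coord x i a) i b = set_coord x i b.
Proof. revert i; induction x as [|c x IH]; intros [|i]; simpl; try easy; now rewrite IH. Qed.

Lemma set_coord_same (x : point) (i : nat) : set_coord x i (coord x i) = x.
Proof. revert i; induction x as [|c x IH]; intros [|i]; simpl; try easy; now rewrite IH. Qed.

Lemma map_set_coord (h : Z -> Z) (x : point) (i : nat) (z : Z) :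
  map h (set_coord x i z) = set_coord (map h x) i (h z).
Proof. revert i; induction x as [|c x IH]; intros [|i]; simpl; try easy; now rewrite IH. Qed.

Lemma coord_map (h : Z -> Z) (x : point) (i : nat) :
  (i < length x)%nat -> coord (map h x) i = h (coord x i).
Proof.
intros Hi; rewrite (nth_indep _ 0%Z (h 0%Z)) by now rewrite length_map.
apply map_nth.
Qed.

Lemma inBox_coord (d L : nat) (x : point) :
  inBox d L x <->
  length x = d /\ forall i, (i < d)%nat -> (0 <= coord x i < Z.of_nat L)%Z.
Proof.
unfold inBox; revert x; induction d as [|d IH]; intros x; simpl.
- split.
  + intros [<-|[]]; split; [easy | lia].
  + intros [H _]; left; symmetry; now apply length_zero_iff_nil.
- rewrite in_flat_map; split.
  + intros (z & Hz & Hx); apply in_map_iff in Hx; destruct Hx as (t & <- & Ht).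
    apply in_map_iff in Hz; destruct Hz as (k & <- & Hk); apply in_seq in Hk.
    apply IH in Ht; destruct Ht as [Hl Ht]; split; [simpl; now rewrite Hl|].
    intros [|i] Hi; simpl; [lia | apply Ht; lia].
  + intros [Hl H]; destruct x as [|z t]; [easy|]; exists z; split.
    * apply in_map_iff; exists (Z.to_nat z); specialize (H O ltac:(lia)); simpl in H.
      split; [lia | apply in_seq; lia].
    * apply in_map, IH; split; [now injection Hl|].
      intros i Hi; apply (H (S i)); lia.
Qed.

Lemma inBox_cons (d L : nat) (z : Z) (x : point) :
  inBox (S d) L (z :: x) <-> (0 <= z < Z.of_nat L)%Z /\ inBox d L x.
Proof.
rewrite !inBox_coord; simpl; split.
- intros [Hl H]; split; [apply (H O); lia|]; split; [lia|].
  intros i Hi; apply (H (S i)); lia.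
- intros (Hz & Hl & H); split; [lia|]; intros [|i] Hi; [easy | apply H; lia].
Qed.

Lemma Sum_box_restrict (d L N : nat) (f : point -> R) :
  (L <= N)%nat -> (forall x, ~ inBox d L x -> f x = 0) ->
  Sum (box d N) f = Sum (box d L) f.
Proof.
intros HLN; revert f; induction d as [|d IH]; intros f Hf; [easy|].
rewrite !Sum_box_S.
replace N with (L + (N - L))%nat at 1 by lia; rewrite seq_app, Sum_app.
rewrite (Sum_zero (seq (0 + L) (N - L))).
- rewrite Rplus_0_r; apply Sum_ext; intros k _; apply IH.
  intros x Hx; apply Hf; rewrite inBox_cons; tauto.
- intros k Hk; apply in_seq in Hk; apply Sum_zero; intros x _.
  apply Hf; rewrite inBox_cons; intros [H _]; lia.
Qed.

(** Each element of [l] where [f] is nonzero uses up one occurrence in [l']. This counts the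
    reflected points. *)
Lemma Sum_NoDup_le {T} (l l' : list T) (f : T -> R) :
  NoDup l -> (forall x, 0 <= f x) -> (forall x, In x l -> f x <> 0 -> In x l') ->
  Sum l f <= Sum l' f.
Proof.
intros Hl Hf; revert l'; induction Hl as [|a l Ha Hl IH]; intros l' H.
- simpl; apply Sum_nonneg; auto.
- destruct (Req_dec (f a) 0) as [H0|H0].
  + simpl; rewrite H0, Rplus_0_l; apply IH; intros x Hx; apply H; now right.
  + destruct (in_split a l') as (l1 & l2 & ->); [apply H; [now left | easy]|].
    rewrite Sum_app; simpl.
    assert (Sum l f <= Sum (l1 ++ l2) f).
    { apply IH; intros x Hx Hx0.
      assert (Hin : In x (l1 ++ a :: l2)) by (apply H; [now right | easy]).
      apply in_app_or in Hin; apply in_or_app.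
      destruct Hin as [Hin|[<-|Hin]]; auto; contradiction. }
    rewrite Sum_app in H1; lra.
Qed.

Section Reflection.

Variable L : nat.
Hypothesis HL : (1 <= L)%nat.

(** One period holds the box, its mirror image and the two mirrors. *)
Let N := (2 * L + 2)%nat.
Let lz := Z.of_nat L.
Let nz := Z.of_nat N.

Definition phase (z : Z) : Z := ((z + 1) mod Z.of_nat (2 * L + 2))%Z.

(* The Dirichlet problem on [0, L) is unfolded across [-1] and [L]; in the phase
   coordinate, [0] and [L + 1] are the two mirrors. A vertex function is extended
   oddly along [vertex_fold] with sign [reflection_sign], and the component along
   an edge evenly along [edge_fold], an edge being named by its left endpoint. *)
Definition vertex_fold (z : Z) : Z :=
  if (phase z <=? Z.of_nat L)%Z then (phase z - 1)%Z
  else (2 * Z.of_nat L + 1 - phase z)%Z.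

Definition edge_fold (z : Z) : Z :=
  if (phase z <=? Z.of_nat L)%Z then (phase z - 1)%Z
  else (2 * Z.of_nat L - phase z)%Z.

Definition reflection_sign (z : Z) : R := if (phase z <=? Z.of_nat L)%Z then 1 else -1.

Lemma phase_range (z : Z) : (0 <= phase z <= 2 * Z.of_nat L + 1)%Z.
Proof.
unfold phase; pose proof (Z.mod_pos_bound (z + 1) (Z.of_nat (2 * L + 2)) ltac:(lia)); lia.
Qed.

Lemma phase_succ (z : Z) :
  phase (z + 1) = if (phase z =? 2 * lz + 1)%Z then 0%Z else (phase z + 1)%Z.
Proof.
unfold phase, lz.
pose proof (Z.mod_pos_bound (z + 1) (Z.of_nat (2 * L + 2)) ltac:(lia)).
rewrite Z.add_mod by lia; rewrite (Z.mod_small 1) by lia.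
destruct (Z.eqb_spec ((z + 1) mod Z.of_nat (2 * L + 2)) (2 * Z.of_nat L + 1)) as [->|Hne].
- replace (2 * Z.of_nat L + 1 + 1)%Z with (Z.of_nat (2 * L + 2)) by lia.
  apply Z.mod_same; lia.
- apply Z.mod_small; lia.
Qed.

Lemma phase_pred (z : Z) :
  phase (z - 1) = if (phase z =? 0)%Z then (2 * lz + 1)%Z else (phase z - 1)%Z.
Proof.
pose proof (phase_succ (z - 1)) as H; replace (z - 1 + 1)%Z with z in H by ring.
pose proof (phase_range (z - 1)); pose proof (phase_range z); unfold lz in *.
destruct (Z.eqb_spec (phase (z - 1)) (2 * Z.of_nat L + 1));
destruct (Z.eqb_spec (phase z) 0); lia.
Qed.

Lemma phase_mod (z : Z) : phase (z mod nz) = phase z.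
Proof. unfold phase, nz, N; now rewrite Z.add_mod_idemp_l by lia. Qed.

(** The coordinate lies on no mirror. *)
Definition regular (z : Z) : Prop := (0 <= vertex_fold z < Z.of_nat L)%Z.

Lemma regular_phase (z : Z) :
  regular z <-> (1 <= phase z <= lz)%Z \/ (lz + 2 <= phase z)%Z.
Proof.
unfold regular, vertex_fold, lz; pose proof (phase_range z).
destruct (Z.leb_spec (phase z) (Z.of_nat L)); lia.
Qed.

Lemma vertex_fold_low (z : Z) : (phase z <= lz)%Z -> vertex_fold z = (phase z - 1)%Z.
Proof. unfold vertex_fold, lz; destruct (Z.leb_spec (phase z) (Z.of_nat L)); lia. Qed.

Lemma vertex_fold_high (z : Z) : (lz < phase z)%Z -> vertex_fold z = (2 * lz + 1 - phase z)%Z.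
Proof. unfold vertex_fold, lz; destruct (Z.leb_spec (phase z) (Z.of_nat L)); lia. Qed.

Lemma edge_fold_low (z : Z) : (phase z <= lz)%Z -> edge_fold z = (phase z - 1)%Z.
Proof. unfold edge_fold, lz; destruct (Z.leb_spec (phase z) (Z.of_nat L)); lia. Qed.

Lemma edge_fold_high (z : Z) : (lz < phase z)%Z -> edge_fold z = (2 * lz - phase z)%Z.
Proof. unfold edge_fold, lz; destruct (Z.leb_spec (phase z) (Z.of_nat L)); lia. Qed.

Lemma reflection_sign_low (z : Z) : (phase z <= lz)%Z -> reflection_sign z = 1.
Proof. unfold reflection_sign, lz; destruct (Z.leb_spec (phase z) (Z.of_nat L)); [easy | lia]. Qed.

Lemma reflection_sign_high (z : Z) : (lz < phase z)%Z -> reflection_sign z = -1.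
Proof. unfold reflection_sign, lz; destruct (Z.leb_spec (phase z) (Z.of_nat L)); [lia | easy]. Qed.

Lemma Rabs_reflection_sign (z : Z) : Rabs (reflection_sign z) = 1.
Proof.
unfold reflection_sign; destruct (_ <=? _)%Z; [apply Rabs_R1|].
rewrite Rabs_left; lra.
Qed.

Definition odd_extension (g : Z -> R) (z : Z) : R := reflection_sign z * g (vertex_fold z).

(** This description and the next overlap at phase [lz + 1], where both vanish, so a neighbour lying
    on that mirror can be read from either side. *)
Lemma odd_extension_low (g : Z -> R) (z : Z) :
  (forall k, ~ (0 <= k < lz)%Z -> g k = 0) ->
  (phase z <= lz + 1)%Z -> odd_extension g z = g (phase z - 1)%Z.
Proof.
intros Hg H; unfold odd_extension; destruct (Z.eq_dec (phase z) (lz + 1)) as [E|E].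
- rewrite vertex_fold_high, (Hg (2 * lz + 1 - phase z)%Z), (Hg (phase z - 1)%Z) by lia; ring.
- rewrite vertex_fold_low, reflection_sign_low by lia; ring.
Qed.

Lemma odd_extension_high (g : Z -> R) (z : Z) :
  (forall k, ~ (0 <= k < lz)%Z -> g k = 0) ->
  (lz + 1 <= phase z)%Z -> odd_extension g z = - g (2 * lz + 1 - phase z)%Z.
Proof.
intros Hg H; unfold odd_extension.
rewrite vertex_fold_high, reflection_sign_high by lia; ring.
Qed.

Ltac case_phase := rewrite ?phase_succ, ?phase_pred;
  match goal with |- context [(?a =? ?b)%Z] => destruct (Z.eqb_spec a b) end; try lia.

(** On a mirror the two neighbours are images of each other and cancel by oddness. Off the mirrors
    the fold is an isometry near [z], possibly reversing left and right, which a symmetric sum does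
    not see. *)
Lemma odd_extension_pair (g : Z -> R) (z : Z) :
  (forall k, ~ (0 <= k < lz)%Z -> g k = 0) ->
  (regular z -> odd_extension g (z + 1) + odd_extension g (z - 1)
    = reflection_sign z * (g (vertex_fold z + 1)%Z + g (vertex_fold z - 1)%Z)) /\
  (~ regular z -> odd_extension g (z + 1) + odd_extension g (z - 1) = 0).
Proof.
intros Hg; pose proof (phase_range z) as Hr; fold lz in Hr; rewrite regular_phase.
assert (HL' : (1 <= lz)%Z) by (unfold lz; lia).
split; intros H.
- destruct H as [H|H].
  + rewrite (odd_extension_low g (z + 1)), (odd_extension_low g (z - 1)) by (easy || case_phase).
    rewrite vertex_fold_low, reflection_sign_low by lia.
    replace (phase (z + 1)) with (phase z + 1)%Z by case_phase.
    replace (phase (z - 1)) with (phase z - 1)%Z by case_phase.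
    rewrite Rmult_1_l; f_equal; f_equal; ring.
  + rewrite (odd_extension_high g (z - 1)) by (easy || case_phase).
    rewrite vertex_fold_high, reflection_sign_high by lia.
    replace (phase (z - 1)) with (phase z - 1)%Z by case_phase.
    replace (odd_extension g (z + 1)) with (- g (2 * lz + 1 - phase z - 1)%Z).
    { replace (2 * lz + 1 - (phase z - 1))%Z with (2 * lz + 1 - phase z + 1)%Z by ring; ring. }
    (* At the end of the period the right neighbour wraps around to the mirror of phase [0], where
       the extension vanishes. *)
    destruct (Z.eq_dec (phase z) (2 * lz + 1)) as [E|E].
    * assert (E' : phase (z + 1) = 0%Z) by case_phase.
      rewrite odd_extension_low, E', !Hg by (easy || lia); ring.
    * assert (E' : phase (z + 1) = (phase z + 1)%Z) by case_phase.
      rewrite odd_extension_high, E' by (easy || lia); f_equal; f_equal; ring.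
- assert (Hz : (phase z = 0 \/ phase z = lz + 1)%Z) by lia.
  destruct Hz as [E|E].
  + assert (E1 : phase (z + 1) = 1%Z) by case_phase.
    assert (E2 : phase (z - 1) = (2 * lz + 1)%Z) by case_phase.
    rewrite odd_extension_low, odd_extension_high, E1, E2 by (easy || lia).
    replace (2 * lz + 1 - (2 * lz + 1))%Z with (1 - 1)%Z by ring; ring.
  + assert (E1 : phase (z + 1) = (lz + 2)%Z) by case_phase.
    assert (E2 : phase (z - 1) = lz) by case_phase.
    rewrite odd_extension_high, odd_extension_low, E1, E2 by (easy || lia).
    replace (2 * lz + 1 - (lz + 2))%Z with (lz - 1)%Z by ring; ring.
Qed.

(** The fold reverses the order of edges on the reflected half, so the divergence of an even edge
    field is odd, like the Laplacian of an odd function. On a mirror the two adjacent edges fold to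
    the same edge. *)
Lemma edge_fold_difference (h : Z -> R) (z : Z) :
  (forall k, ~ (0 <= k < lz)%Z -> h k = 0) ->
  (regular z -> h (edge_fold z) - h (edge_fold (z - 1))
    = reflection_sign z * (h (vertex_fold z) - h (vertex_fold z - 1)%Z)) /\
  (~ regular z -> h (edge_fold z) - h (edge_fold (z - 1)) = 0).
Proof.
intros Hh; pose proof (phase_range z) as Hr; fold lz in Hr; rewrite regular_phase.
assert (HL' : (1 <= lz)%Z) by (unfold lz; lia).
split; intros H.
- assert (E : phase (z - 1) = (phase z - 1)%Z) by case_phase.
  destruct H as [H|H].
  + rewrite !edge_fold_low, vertex_fold_low, reflection_sign_low, E by lia; ring.
  + rewrite !edge_fold_high, vertex_fold_high, reflection_sign_high, E by lia.
    replace (2 * lz - (phase z - 1))%Z with (2 * lz + 1 - phase z)%Z by ring.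
    replace (2 * lz - phase z)%Z with (2 * lz + 1 - phase z - 1)%Z by ring; ring.
- assert (Hz : (phase z = 0 \/ phase z = lz + 1)%Z) by lia.
  destruct Hz as [E|E].
  + assert (E2 : phase (z - 1) = (2 * lz + 1)%Z) by case_phase.
    rewrite edge_fold_low, edge_fold_high, E, E2 by lia.
    rewrite !Hh by lia; ring.
  + assert (E2 : phase (z - 1) = lz) by case_phase.
    rewrite edge_fold_high, edge_fold_low, E, E2 by lia.
    replace (2 * lz - (lz + 1))%Z with (lz - 1)%Z by ring; ring.
Qed.

Lemma phase_in_box (z : Z) : (0 <= z <= lz)%Z -> phase z = (z + 1)%Z.
Proof. unfold phase, lz; intros H; apply Z.mod_small; lia. Qed.

(** A point of the box has at most two preimages in a period: itself and one point of the reflected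
    half, where the fold is [c - z]. *)
Lemma Sum_fold_le (m : Z -> Z) (c : Z) (psi : Z -> R) :
  (forall z, (0 <= z < lz)%Z -> m z = z) ->
  (forall z, (lz <= z < nz)%Z -> m z = (c - z)%Z \/ ~ (0 <= m z < lz)%Z) ->
  (forall z, 0 <= psi z) -> (forall z, ~ (0 <= z < lz)%Z -> psi z = 0) ->
  Sum (seq 0 N) (fun k => psi (m (Z.of_nat k)))
  <= 2 * Sum (seq 0 L) (fun k => psi (Z.of_nat k)).
Proof.
intros Hlow Hhigh Hpsi Hout.
replace N with (L + (L + 2))%nat by (unfold N; lia); rewrite seq_app, Sum_app.
assert (H1 : Sum (seq 0 L) (fun k => psi (m (Z.of_nat k)))
  = Sum (seq 0 L) (fun k => psi (Z.of_nat k))).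
{ apply Sum_ext; intros k Hk; apply in_seq in Hk; rewrite Hlow; [easy | unfold lz; lia]. }
assert (H2 : Sum (seq (0 + L) (L + 2)) (fun k => psi (m (Z.of_nat k)))
  <= Sum (map (fun k => c - Z.of_nat k)%Z (seq (0 + L) (L + 2))) psi).
{ rewrite Sum_map; apply Sum_le; intros k Hk; apply in_seq in Hk.
  destruct (Hhigh (Z.of_nat k)) as [->|Hk']; [unfold lz, nz, N; lia | lra|].
  now rewrite (Hout (m _)). }
assert (H3 : Sum (map (fun k => c - Z.of_nat k)%Z (seq (0 + L) (L + 2))) psi
  <= Sum (map Z.of_nat (seq 0 L)) psi).
{ apply Sum_NoDup_le; [|easy|].
  - apply NoDup_map_NoDup_ForallPairs; [|apply seq_NoDup].
    intros a b _ _ E; lia.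
  - intros z _ Hz.
    assert (Hz' : (0 <= z < lz)%Z).
    { destruct (Z_le_dec 0 z), (Z_lt_dec z lz); try lia; exfalso; apply Hz, Hout; lia. }
    apply in_map_iff; exists (Z.to_nat z); unfold lz in *; split; [lia | apply in_seq; lia]. }
rewrite (Sum_map (seq 0 L)) in H3; lra.
Qed.

Lemma Sum_vertex_fold_le (psi : Z -> R) :
  (forall z, 0 <= psi z) -> (forall z, ~ (0 <= z < lz)%Z -> psi z = 0) ->
  Sum (seq 0 N) (fun k => psi (vertex_fold (Z.of_nat k)))
  <= 2 * Sum (seq 0 L) (fun k => psi (Z.of_nat k)).
Proof.
apply Sum_fold_le with (c := (2 * lz)%Z).
- intros z Hz; rewrite vertex_fold_low; rewrite phase_in_box by lia; lia.
(* The last point of the period is congruent to the mirror [-1]; its phase is [0], so the formula of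
   the reflected half does not apply. *)
- intros z Hz; destruct (Z.eq_dec z (2 * lz + 1)) as [->|Hne].
  + right.
    assert (E : phase (2 * lz + 1) = 0%Z).
    { unfold phase, lz; replace (2 * Z.of_nat L + 1 + 1)%Z with (Z.of_nat (2 * L + 2)) by lia.
      apply Z.mod_same; lia. }
    rewrite vertex_fold_low; rewrite E; unfold lz; lia.
  + left; assert (E : phase z = (z + 1)%Z)
      by (unfold phase; unfold nz, N, lz in *; apply Z.mod_small; lia).
    rewrite vertex_fold_high; rewrite E; lia.
Qed.

Lemma Sum_edge_fold_le (psi : Z -> R) :
  (forall z, 0 <= psi z) -> (forall z, ~ (0 <= z < lz)%Z -> psi z = 0) ->
  Sum (seq 0 N) (fun k => psi (edge_fold (Z.of_nat k)))
  <= 2 * Sum (seq 0 L) (fun k => psi (Z.of_nat k)).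
Proof.
apply Sum_fold_le with (c := (2 * lz - 1)%Z).
- intros z Hz; rewrite edge_fold_low; rewrite phase_in_box by lia; lia.
- intros z Hz; destruct (Z.eq_dec z (2 * lz + 1)) as [->|Hne].
  + right.
    assert (E : phase (2 * lz + 1) = 0%Z).
    { unfold phase, lz; replace (2 * Z.of_nat L + 1 + 1)%Z with (Z.of_nat (2 * L + 2)) by lia.
      apply Z.mod_same; lia. }
    rewrite edge_fold_low; rewrite E; unfold lz; lia.
  + left; assert (E : phase z = (z + 1)%Z)
      by (unfold phase; unfold nz, N, lz in *; apply Z.mod_small; lia).
    rewrite edge_fold_high; rewrite E; lia.
Qed.

Definition point_sign (x : point) : R := fold_right (fun z r => reflection_sign z * r) 1 x.

Lemma Rabs_point_sign (x : point) : Rabs (point_sign x) = 1.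
Proof.
induction x as [|a x IH]; simpl; [apply Rabs_R1|].
rewrite Rabs_mult, IH, Rabs_reflection_sign; ring.
Qed.

Lemma reflection_sign_0 : reflection_sign 0 = 1.
Proof. apply reflection_sign_low; rewrite phase_in_box; unfold lz; lia. Qed.

Lemma point_sign_set_coord (x : point) (i : nat) (z : Z) :
  (i < length x)%nat ->
  point_sign (set_coord x i z) = reflection_sign z * point_sign (set_coord x i 0).
Proof.
revert i; induction x as [|a x IH]; intros [|i] H; simpl in *; try lia.
- rewrite reflection_sign_0; ring.
- rewrite IH by lia; ring.
Qed.

Definition extend (u : point -> R) : point -> R :=
  fun x => point_sign x * u (map vertex_fold x).

(* [set_coord x i 0] drops direction [i] from the sign, since [0] has sign [1]. *)
Definition extend_field (F : point -> nat -> R) : point -> nat -> R :=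
  fun x i => point_sign (set_coord x i 0)
    * F (set_coord (map vertex_fold x) i (edge_fold (coord x i))) i.

(** The representative in the fundamental box. Factoring through it proves periodicity, and
    composing with it makes any function periodic. *)
Definition residue (x : point) : point := map (fun z => z mod nz)%Z x.

Lemma residue_upd (x : point) (i : nat) : residue (upd x i nz) = residue x.
Proof.
unfold residue; revert i; induction x as [|a x IH]; intros [|i]; simpl; try easy.
- f_equal; rewrite <- (Z.mul_1_l nz) at 1; apply Z.mod_add; unfold nz, N; lia.
- now rewrite IH.
Qed.

Lemma residue_in_box (d : nat) (x : point) : In x (box d N) -> residue x = x.
Proof.
unfold residue; revert x; induction d as [|d IH]; intros x Hx.
- destruct Hx as [<-|[]]; reflexivity.
- destruct x as [|z t]; [easy|]; apply inBox_cons in Hx; destruct Hx as [Hz Ht]; simpl.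
  rewrite IH by easy; f_equal; now apply Z.mod_small.
Qed.

Lemma periodic_of_residue (f : point -> R) :
  (forall x, f (residue x) = f x) -> periodic N f.
Proof. intros H x i; rewrite <- (H (upd x i _)), <- (H x); f_equal; apply residue_upd. Qed.

Lemma periodic_comp_residue (f : point -> R) : periodic N (fun x => f (residue x)).
Proof. intros x i; f_equal; apply residue_upd. Qed.

Lemma map_vertex_fold_residue (x : point) :
  map vertex_fold (residue x) = map vertex_fold x.
Proof.
unfold residue; rewrite map_map; apply map_ext; intros z.
unfold vertex_fold; now rewrite phase_mod.
Qed.

Lemma point_sign_residue (x : point) : point_sign (residue x) = point_sign x.
Proof.
induction x as [|z x IH]; simpl; [easy|].
unfold reflection_sign; now rewrite phase_mod, IH.
Qed.

Lemma extend_periodic (u : point -> R) : periodic N (extend u).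
Proof.
apply periodic_of_residue; intros x; unfold extend.
now rewrite map_vertex_fold_residue, point_sign_residue.
Qed.

Lemma extend_field_periodic (F : point -> nat -> R) (i : nat) :
  periodic N (fun x => extend_field F x i).
Proof.
apply periodic_of_residue; intros x; unfold extend_field.
assert (E1 : set_coord (residue x) i 0 = residue (set_coord x i 0)).
{ unfold residue; rewrite map_set_coord; f_equal. }
rewrite E1, point_sign_residue, map_vertex_fold_residue.
assert (E2 : coord (residue x) i = (coord x i mod nz)%Z).
{ unfold residue; replace 0%Z with (0 mod nz)%Z at 1 by reflexivity.
  apply (map_nth (fun z => z mod nz)%Z). }
rewrite E2; unfold edge_fold; now rewrite phase_mod.
Qed.

Lemma not_inBox_set_coord (d : nat) (y : point) (i : nat) (k : Z) :
  (i < length y)%nat -> ~ (0 <= k < lz)%Z -> ~ inBox d L (set_coord y i k).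
Proof.
intros Hi Hk H; apply inBox_coord in H; destruct H as [Hl H].
rewrite length_set_coord in Hl; specialize (H i ltac:(lia)).
rewrite coord_set_coord_eq in H by easy; now apply Hk.
Qed.

Section Equation.

Variables (d : nat) (F : point -> nat -> R) (u : point -> R).
Hypothesis HF : forall x i, ~ inBox d L x -> F x i = 0.
Hypothesis Hu : forall x, ~ inBox d L x -> u x = 0.

(** With the other coordinates frozen and their sign [s] absorbed in [g], the extension along
    direction [i] is the odd extension of [g]. *)
Lemma extend_second_difference (x : point) (i : nat) :
  (i < length x)%nat ->
  (regular (coord x i) ->
    extend u (upd x i 1) + extend u (upd x i (-1)) - 2 * extend u x
    = point_sign x * (u (upd (map vertex_fold x) i 1) + u (upd (map vertex_fold x) i (-1))
        - 2 * u (map vertex_fold x))) /\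
  (~ regular (coord x i) ->
    extend u (upd x i 1) + extend u (upd x i (-1)) - 2 * extend u x = 0).
Proof.
intros Hi.
set (y := map vertex_fold x); set (z := coord x i).
set (s := point_sign (set_coord x i 0)).
set (g := fun k => s * u (set_coord y i k)).
assert (Hg : forall k, ~ (0 <= k < lz)%Z -> g k = 0).
{ intros k Hk; unfold g; rewrite Hu; [ring|].
  apply not_inBox_set_coord; [unfold y; now rewrite length_map | easy]. }
assert (E : forall k, extend u (set_coord x i k) = odd_extension g k).
{ intros k; unfold extend, odd_extension, g.
  rewrite point_sign_set_coord, map_set_coord by easy; fold y s; ring. }
assert (E0 : extend u x = odd_extension g z) by (rewrite <- E; unfold z; now rewrite set_coord_same).
assert (Ey : coord y i = vertex_fold z) by (now apply coord_map).
rewrite !(upd_set_coord x), !(upd_set_coord y), !E, E0, Ey; fold z.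
destruct (odd_extension_pair g z Hg) as [H1 H2].
change (z + -1)%Z with (z - 1)%Z; change (vertex_fold z + -1)%Z with (vertex_fold z - 1)%Z.
assert (Es : point_sign x = reflection_sign z * s).
{ rewrite <- (set_coord_same x i) at 1; now apply point_sign_set_coord. }
split; intros Hz.
- rewrite (H1 Hz), Es; unfold odd_extension, g.
  rewrite <- Ey at 3; rewrite set_coord_same; ring.
- rewrite (H2 Hz); unfold odd_extension; rewrite Hg by exact Hz; ring.
Qed.

Lemma extend_field_difference (x : point) (i : nat) :
  (i < length x)%nat ->
  (regular (coord x i) ->
    extend_field F x i - extend_field F (upd x i (-1)) i
    = point_sign x * (F (map vertex_fold x) i - F (upd (map vertex_fold x) i (-1)) i)) /\
  (~ regular (coord x i) ->
    extend_field F x i - extend_field F (upd x i (-1)) i = 0).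
Proof.
intros Hi.
set (y := map vertex_fold x); set (z := coord x i).
set (s := point_sign (set_coord x i 0)).
set (h := fun k => s * F (set_coord y i k) i).
assert (Hh : forall k, ~ (0 <= k < lz)%Z -> h k = 0).
{ intros k Hk; unfold h; rewrite HF; [ring|].
  apply not_inBox_set_coord; [unfold y; now rewrite length_map | easy]. }
assert (E : forall k, extend_field F (set_coord x i k) i = h (edge_fold k)).
{ intros k; unfold extend_field, h.
  now rewrite set_coord_twice, map_set_coord, set_coord_twice, coord_set_coord_eq. }
assert (E0 : extend_field F x i = h (edge_fold z))
  by (rewrite <- E; unfold z; now rewrite set_coord_same).
assert (Ey : coord y i = vertex_fold z) by (now apply coord_map).
rewrite !(upd_set_coord x), !(upd_set_coord y), !E, E0, Ey; fold z.
destruct (edge_fold_difference h z Hh) as [H1 H2].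
change (z + -1)%Z with (z - 1)%Z; change (vertex_fold z + -1)%Z with (vertex_fold z - 1)%Z.
assert (Es : point_sign x = reflection_sign z * s).
{ rewrite <- (set_coord_same x i) at 1; now apply point_sign_set_coord. }
split; intros Hz; [|exact (H2 Hz)].
rewrite (H1 Hz), Es; unfold h.
rewrite <- Ey at 1; rewrite set_coord_same; ring.
Qed.

Lemma lap_sum_dir (f : point -> R) (x : point) :
  lap d f x = Sum (seq 0 d) (fun i => f (upd x i 1) + f (upd x i (-1)) - 2 * f x).
Proof.
unfold lap, div, sum_dir, grad; apply Sum_ext; intros i _; rewrite upd_upd, upd_0; ring.
Qed.

Hypothesis Heq : forall x, inBox d L x -> - lap d u x = div d F x.

(** If no coordinate lies on a mirror, the folded point is in the box and the equation there is
    multiplied by the sign of the point. If coordinate [k] lies on one, every term is zero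
    separately: direction [k] by symmetry, the others because their folded points keep a [k]-th
    coordinate outside the box. *)
Lemma extend_equation (x : point) : - lap d (extend u) x = div d (extend_field F) x.
Proof.
set (y := map vertex_fold x).
assert (Ly : length y = length x) by apply length_map.
destruct (Nat.eq_dec (length x) d) as [Hl|Hl].
(* The torus estimate asks for the equation at every list; when the length differs from [d], both
   sides vanish. *)
2:{ assert (Eu : forall x', length x' <> d -> extend u x' = 0).
    { intros x' Hx'; unfold extend; rewrite Hu; [ring|].
      intros H; apply inBox_coord in H; rewrite length_map in H; tauto. }
    assert (EF : forall x' i, length x' <> d -> extend_field F x' i = 0).
    { intros x' i Hx'; unfold extend_field; rewrite HF; [ring|].
      intros H; apply inBox_coord in H; rewrite length_set_coord, length_map in H; tauto. }
    rewrite lap_sum_dir; unfold div, sum_dir.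
    rewrite !Sum_zero; [ring| |]; intros i _;
      rewrite ?Eu, ?EF by (rewrite ?upd_set_coord, ?length_set_coord; easy); ring. }
rewrite lap_sum_dir; unfold div, sum_dir.
assert (Dec : forall n, (forall i, (i < n)%nat -> regular (coord x i)) \/
  exists i, (i < n)%nat /\ ~ regular (coord x i)).
{ induction n as [|n [IH|(i & Hi & IH)]]; [left; lia | | right; exists i; split; [lia | easy]].
  destruct (Z_le_dec 0 (vertex_fold (coord x n))), (Z_lt_dec (vertex_fold (coord x n)) (Z.of_nat L)).
  - left; intros i Hi; destruct (Nat.eq_dec i n) as [->|]; [now split | apply IH; lia].
  - right; exists n; split; [lia | unfold regular; tauto].
  - right; exists n; split; [lia | unfold regular; tauto].
  - right; exists n; split; [lia | unfold regular; tauto]. }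
destruct (Dec d) as [Hreg|(k & Hk & Hsing)].
- assert (Hy : inBox d L y).
  { apply inBox_coord; split; [lia|]; intros i Hi; unfold y; rewrite coord_map by lia.
    now apply Hreg. }
  rewrite (Sum_ext (seq 0 d) (fun i => extend u (upd x i 1) + _ - _) (fun i => point_sign x *
    (u (upd y i 1) + u (upd y i (-1)) - 2 * u y))).
  2:{ intros i Hi; apply in_seq in Hi; apply extend_second_difference; [lia | apply Hreg; lia]. }
  rewrite (Sum_ext (seq 0 d) (fun i => extend_field F x i - _) (fun i => point_sign x *
    (F y i - F (upd y i (-1)) i))).
  2:{ intros i Hi; apply in_seq in Hi; apply extend_field_difference; [lia | apply Hreg; lia]. }
  rewrite !Sum_scal, <- lap_sum_dir.
  change (- (point_sign x * lap d u y) = point_sign x * div d F y).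
  rewrite <- Heq by easy; ring.
- assert (Hout : forall w, coord w k = vertex_fold (coord x k) -> ~ inBox d L w).
  { intros w Hw H; apply inBox_coord in H; destruct H as [_ H]; specialize (H k Hk).
    rewrite Hw in H; now apply Hsing. }
  assert (Hyk : coord y k = vertex_fold (coord x k)) by (apply coord_map; lia).
  assert (Hupd : forall i c, i <> k -> ~ inBox d L (upd y i c)).
  { intros i c Hik; apply Hout; rewrite upd_set_coord, coord_set_coord_neq by easy; easy. }
  assert (Hcase : forall i, regular (coord x i) -> i <> k) by (intros i Hi ->; easy).
  assert (Hdec : forall i, (i < d)%nat -> regular (coord x i) \/ ~ regular (coord x i)).
  { intros i Hi; unfold regular.
    destruct (Z_le_dec 0 (vertex_fold (coord x i))),
      (Z_lt_dec (vertex_fold (coord x i)) (Z.of_nat L)); tauto. }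
  rewrite !Sum_zero; [ring| |]; intros i Hi; apply in_seq in Hi;
    destruct (Hdec i ltac:(lia)) as [Hr|Hr].
  + rewrite (proj1 (extend_field_difference x i ltac:(lia)) Hr); fold y.
    rewrite !HF; [ring | apply Hupd, Hcase, Hr | now apply Hout].
  + now apply extend_field_difference; [lia|].
  + rewrite (proj1 (extend_second_difference x i ltac:(lia)) Hr); fold y.
    rewrite !Hu; [ring | now apply Hout | apply Hupd, Hcase, Hr | apply Hupd, Hcase, Hr].
  + now apply extend_second_difference; [lia|].
Qed.

(** The range includes the mirror [lz], since forward differences at the upper faces of the box
    reach it. *)
Lemma extend_in_box (x : point) :
  length x = d -> (forall i, (i < d)%nat -> (0 <= coord x i <= lz)%Z) -> extend u x = u x.
Proof.
intros Hl Hx.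
assert (Hph : forall i, (i < d)%nat -> phase (coord x i) = (coord x i + 1)%Z)
  by (intros i Hi; now apply phase_in_box, Hx).
assert (Hv : map vertex_fold x = x).
{ apply nth_ext with (d := 0%Z) (d' := 0%Z); [apply length_map|].
  intros i Hi; rewrite length_map in Hi; rewrite coord_map by easy.
  specialize (Hx i ltac:(lia)); specialize (Hph i ltac:(lia)).
  destruct (Z.eq_dec (coord x i) lz).
  - rewrite vertex_fold_high; rewrite Hph; lia.
  - rewrite vertex_fold_low; rewrite Hph; lia. }
unfold extend; rewrite Hv.
assert (Dec : (forall i, (i < d)%nat -> (coord x i < lz)%Z) \/ ~ inBox d L x).
{ destruct (in_dec (list_eq_dec Z.eq_dec) x (box d L)) as [H|H]; [left | now right].
  apply inBox_coord in H; intros i Hi; now apply H. }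
destruct Dec as [Hlt|Hout]; [|rewrite Hu by easy; ring].
assert (Hs : forall w, (forall z, In z w -> (phase z <= lz)%Z) -> point_sign w = 1).
{ induction w as [|z w IH]; intros Hlow; [easy|]; simpl.
  rewrite reflection_sign_low by (apply Hlow; now left).
  rewrite IH by (intros z' Hz'; apply Hlow; now right); ring. }
rewrite Hs; [ring|]; intros z Hz.
apply (In_nth _ _ 0%Z) in Hz; destruct Hz as (i & Hi & <-).
specialize (Hlt i ltac:(lia)); rewrite Hph by lia; lia.
Qed.

Lemma grad_extend_in_box (x : point) (j : nat) :
  inBox d L x -> grad (extend u) x j = grad u x j.
Proof.
intros Hx; apply inBox_coord in Hx; destruct Hx as [Hl Hx]; unfold grad.
fold lz in Hx.
rewrite !extend_in_box; [easy | easy | intros i Hi; specialize (Hx i Hi); lia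
  | now rewrite upd_set_coord, length_set_coord |].
intros i Hi; rewrite upd_set_coord; destruct (Nat.eq_dec i j) as [->|Hne].
- rewrite coord_set_coord_eq by lia; specialize (Hx j Hi); lia.
- rewrite coord_set_coord_neq by auto; specialize (Hx i Hi); lia.
Qed.

End Equation.

(** Folding covers the box at most twice in each coordinate. *)
Lemma Sum_map_vertex_fold_le (d : nat) (psi : point -> R) :
  (forall x, 0 <= psi x) -> (forall x, ~ inBox d L x -> psi x = 0) ->
  Sum (box d N) (fun x => psi (map vertex_fold x)) <= 2 ^ d * Sum (box d L) psi.
Proof.
revert psi; induction d as [|d IH]; intros psi Hpsi Hout; [simpl; lra|].
rewrite !Sum_box_S; simpl map.
rewrite Sum_swap.
apply Rle_trans with (Sum (box d N) (fun x =>
  2 * Sum (seq 0 L) (fun k => psi (Z.of_nat k :: map vertex_fold x)))).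
- apply Sum_le; intros x _.
  apply (Sum_vertex_fold_le (fun z => psi (z :: map vertex_fold x))); [auto|].
  intros z Hz; apply Hout; rewrite inBox_cons; tauto.
- rewrite Sum_scal, Sum_swap; simpl pow; rewrite Rmult_assoc.
  apply Rmult_le_compat_l; [lra|]; rewrite <- Sum_scal; apply Sum_le; intros k _.
  apply (IH (fun x => psi (Z.of_nat k :: x))); [auto|].
  intros x Hx; apply Hout; rewrite inBox_cons; tauto.
Qed.

Lemma Sum_edge_point_fold_le (d i : nat) (psi : point -> R) :
  (forall x, 0 <= psi x) -> (forall x, ~ inBox d L x -> psi x = 0) ->
  Sum (box d N) (fun x => psi (set_coord (map vertex_fold x) i (edge_fold (coord x i))))
  <= 2 ^ d * Sum (box d L) psi.
Proof.
revert i psi; induction d as [|d IH]; intros i psi Hpsi Hout; [simpl; lra|].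
rewrite !Sum_box_S; destruct i as [|i]; simpl map; simpl nth; simpl set_coord.
- rewrite Sum_swap.
  apply Rle_trans with (Sum (box d N) (fun x =>
    2 * Sum (seq 0 L) (fun k => psi (Z.of_nat k :: map vertex_fold x)))).
  + apply Sum_le; intros x _.
    apply (Sum_edge_fold_le (fun z => psi (z :: map vertex_fold x))); [auto|].
    intros z Hz; apply Hout; rewrite inBox_cons; tauto.
  + rewrite Sum_scal, Sum_swap; simpl pow; rewrite Rmult_assoc.
    apply Rmult_le_compat_l; [lra|]; rewrite <- Sum_scal; apply Sum_le; intros k _.
    apply (Sum_map_vertex_fold_le d (fun x => psi (Z.of_nat k :: x))); [auto|].
    intros x Hx; apply Hout; rewrite inBox_cons; tauto.
- rewrite Sum_swap.
  apply Rle_trans with (Sum (box d N) (fun x => 2 * Sum (seq 0 L) (fun k =>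
    psi (Z.of_nat k :: set_coord (map vertex_fold x) i (edge_fold (coord x i)))))).
  + apply Sum_le; intros x _.
    apply (Sum_vertex_fold_le
      (fun z => psi (z :: set_coord (map vertex_fold x) i (edge_fold (coord x i))))); [auto|].
    intros z Hz; apply Hout; rewrite inBox_cons; tauto.
  + rewrite Sum_scal, Sum_swap; simpl pow; rewrite Rmult_assoc.
    apply Rmult_le_compat_l; [lra|]; rewrite <- Sum_scal; apply Sum_le; intros k _.
    apply (IH i (fun x => psi (Z.of_nat k :: x))); [auto|].
    intros x Hx; apply Hout; rewrite inBox_cons; tauto.
Qed.

End Reflection.

(** * The estimate on the box *)

Lemma rpow_Rabs_plus_le (p a b : R) :
  0 <= p -> rpow (Rabs (a + b)) p <= rpow 2 p * (rpow (Rabs a) p + rpow (Rabs b) p).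
Proof.
intros Hp.
pose proof (rpow_Sum_le (a :: b :: nil) Rabs p Hp ltac:(intros; apply Rabs_pos)) as H.
simpl in H; rewrite !Rplus_0_r in H.
eapply Rle_trans; [|exact H].
apply rpow_le; [easy | split; [apply Rabs_pos | apply Rabs_triang]].
Qed.

(** By Jensen the walk does not increase the sum of [p]-th powers, so [f] and [walk d f] contribute
    equally. *)
Lemma Sum_plus_walk_le (d N : nat) (p : R) (f : point -> R) :
  1 < p -> periodic N f ->
  Sum (box d N) (fun x => rpow (Rabs (f x + walk d f x)) p)
  <= 2 * rpow 2 p * Sum (box d N) (fun x => rpow (Rabs (f x)) p).
Proof.
intros Hp Hf.
assert (Hfp : periodic N (fun x => rpow (Rabs (f x)) p)) by (intros x i; now rewrite Hf).
apply Rle_trans with (Sum (box d N) (fun x => rpow 2 p * (rpow (Rabs (f x)) p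
  + walk d (fun y => rpow (Rabs (f y)) p) x))).
- apply Sum_le; intros x _.
  eapply Rle_trans; [apply rpow_Rabs_plus_le; lra|].
  apply Rmult_le_compat_l; [apply rpow_nonneg|]; apply Rplus_le_compat_l.
  apply (subdifferentiable_jensen (fun t => rpow (Rabs t) p));
    [now apply subdifferentiable_Rabs_rpow | easy].
- rewrite Sum_scal, Sum_plus, (Sum_box_walk d N (fun y => rpow (Rabs (f y)) p)) by easy; lra.
Qed.

Lemma Sum_extend_field_le (d L i : nat) (p : R) (F : point -> nat -> R) :
  (1 <= L)%nat -> (forall x i, ~ inBox d L x -> F x i = 0) ->
  Sum (box d (2 * L + 2)) (fun x => rpow (Rabs (extend_field L F x i)) p)
  <= 2 ^ d * Sum (box d L) (fun x => rpow (Rabs (F x i)) p).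
Proof.
intros HL HF.
rewrite (Sum_ext _ _ (fun x => rpow (Rabs (F (set_coord (map (vertex_fold L) x) i
  (edge_fold L (coord x i))) i)) p)).
- apply (Sum_edge_point_fold_le L HL d i (fun y => rpow (Rabs (F y i)) p)).
  + intros; apply rpow_nonneg.
  + intros x Hx; rewrite HF by easy; now rewrite Rabs_R0, rpow_0.
- intros x _; unfold extend_field; now rewrite Rabs_mult, Rabs_point_sign, Rmult_1_l.
Qed.

(** The right side is a sum of powers, as is the bound on [B]; homogeneity is recovered later by
    scaling. *)
Lemma box_duality_estimate (d : nat) (p : R) :
  1 < p -> exists C, 0 <= C /\
  forall (L : nat) (F : point -> nat -> R) (u g : point -> R) (j : nat),
    (1 <= L)%nat ->
    (forall x i, ~ inBox d L x -> F x i = 0) ->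
    (forall x, ~ inBox d L x -> u x = 0) ->
    (forall x, ~ inBox d L x -> g x = 0) ->
    (forall x, inBox d L x -> - lap d u x = div d F x) -> (j < d)%nat ->
    Sum (box d L) (fun x => grad u x j * g x)
    <= C * (Sum (seq 0 d) (fun i => Sum (box d L) (fun x => rpow (Rabs (F x i)) p))
            + Sum (box d L) (fun x => rpow (Rabs (g x)) (p / (p - 1)))).
Proof.
intros Hp; destruct (bellman p Hp) as (B & C & HC & HB & Hplus & Hminus).
pose proof (pos_INR d) as Hd; pose proof (rpow_nonneg 2 p) as H2.
(* The factor [2 * rpow 2 p] pays for [F + P F], and [2 ^ d] for folding the field onto the box. *)
set (c := 2 * rpow 2 p * 2 ^ d).
assert (Hc : 0 <= c) by (apply Rmult_le_pos; [lra | apply pow_le; lra]).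
set (A := 16 * (2 * INR d + 1) * C).
assert (HA : 0 <= A) by (apply Rmult_le_pos; lra).
exists (A * (c + INR d)); split; [apply Rmult_le_pos; lra|].
intros L F u g j HL HF Hu Hg Heq Hj.
set (N := (2 * L + 2)%nat).
(* Unlike [F] and [u], the test function is continued by zero over the period, without reflection:
   the torus pairing then sees only the original box. *)
set (h := fun x => g (residue L x)).
set (q := p / (p - 1)) in *.
set (SF := Sum (seq 0 d) (fun i => Sum (box d L) (fun x => rpow (Rabs (F x i)) p))).
set (SG := Sum (box d L) (fun x => rpow (Rabs (g x)) q)).
assert (HSF : 0 <= SF)
  by (apply Sum_nonneg; intros; apply Sum_nonneg; intros; apply rpow_nonneg).
assert (HSG : 0 <= SG) by (apply Sum_nonneg; intros; apply rpow_nonneg).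
assert (Epair : Sum (box d N) (fun x => grad (extend L u) x j * h x)
  = Sum (box d L) (fun x => grad u x j * g x)).
{ rewrite (Sum_ext _ _ (fun x => grad (extend L u) x j * g x)).
  - rewrite (Sum_box_restrict d L N); [|unfold N; lia | intros x Hx; rewrite Hg by easy; ring].
    apply Sum_ext; intros x Hx; f_equal; now apply grad_extend_in_box with d.
  - intros x Hx; unfold h; now rewrite (residue_in_box L d). }
assert (Eg : Sum (box d N) (fun x => rpow (Rabs (h x)) q) = SG).
{ rewrite (Sum_ext _ _ (fun x => rpow (Rabs (g x)) q)).
  - apply Sum_box_restrict; [unfold N; lia|]; intros x Hx.
    rewrite Hg by easy; now rewrite Rabs_R0, rpow_0.
  - intros x Hx; unfold h; now rewrite (residue_in_box L d). }
rewrite <- Epair; eapply Rle_trans; [apply Rle_abs|].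
eapply Rle_trans.
{ apply (torus_bilinear_estimate d N j B (extend_field L F) (extend L u) h).
  - intros a b; apply HB.
  - now split.
  - now apply extend_periodic.
  - now apply periodic_comp_residue.
  - intros i; now apply extend_field_periodic.
  - now apply extend_equation.
  - easy. }
apply Rle_trans with (16 * (2 * INR d + 1) * Sum (seq 0 d) (fun i =>
  C * (c * Sum (box d L) (fun x => rpow (Rabs (F x i)) p) + SG))).
- apply Rmult_le_compat_l; [lra|]; apply Sum_le; intros i _.
  eapply Rle_trans; [apply Sum_le; intros x _; apply HB|].
  rewrite Sum_scal, Sum_plus, Eg; apply Rmult_le_compat_l; [easy|].
  apply Rplus_le_compat_r.
  eapply Rle_trans; [apply (Sum_plus_walk_le d N p (fun y => extend_field L F y i)); [easy|]|].
  + now apply extend_field_periodic.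
  + unfold c; rewrite (Rmult_assoc (2 * rpow 2 p)); apply Rmult_le_compat_l; [lra|].
    now apply Sum_extend_field_le.
- rewrite Sum_scal, Sum_plus, Sum_scal, Sum_const, length_seq; fold SF.
  replace (16 * (2 * INR d + 1) * (C * (c * SF + INR d * SG)))
    with (A * (c * SF + INR d * SG)) by (unfold A; ring).
  rewrite Rmult_assoc; apply Rmult_le_compat_l; [easy|].
  assert (0 <= c * SG) by now apply Rmult_le_pos.
  assert (0 <= INR d * SF) by now apply Rmult_le_pos.
  lra.
Qed.

(** * Testing with the dual power, and the norm estimate *)

Lemma grad_scal (k : R) (u : point -> R) (x : point) (i : nat) :
  grad (fun y => k * u y) x i = k * grad u x i.
Proof. unfold grad; ring. Qed.

Lemma div_scal (d : nat) (k : R) (F : point -> nat -> R) (x : point) :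
  div d (fun y i => k * F y i) x = k * div d F x.
Proof.
unfold div, sum_dir; rewrite <- Sum_scal; apply Sum_ext; intros; ring.
Qed.

Lemma lap_scal (d : nat) (k : R) (u : point -> R) (x : point) :
  lap d (fun y => k * u y) x = k * lap d u x.
Proof.
unfold lap; rewrite <- div_scal; unfold div, sum_dir; apply Sum_ext; intros.
now rewrite !grad_scal.
Qed.

(** The function [t |t|^(p-2)] is extremal in Hölder's inequality. At [t = 0] with [p < 2] the
    identities rely on the convention that [rpow] vanishes at [0]. *)
Lemma dual_power (p t : R) :
  1 < p ->
  t * (t * rpow (Rabs t) (p - 2)) = rpow (Rabs t) p /\
  rpow (Rabs (t * rpow (Rabs t) (p - 2))) (p / (p - 1)) = rpow (Rabs t) p.
Proof.
intros Hp; pose proof (Rabs_pos t) as Ht.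
assert (E : Rabs t * rpow (Rabs t) (p - 2) = rpow (Rabs t) (p - 1)).
{ rewrite Rmult_comm; rewrite <- (rpow_succ (Rabs t) (p - 1)) by easy; f_equal; f_equal; ring. }
split.
- replace (t * (t * rpow (Rabs t) (p - 2)))
    with (Rabs t * Rabs t * rpow (Rabs t) (p - 2)).
  + rewrite Rmult_assoc, E, Rmult_comm; now apply rpow_succ.
  + rewrite <- Rabs_mult, Rabs_pos_eq by nra; ring.
- rewrite Rabs_mult, (Rabs_pos_eq (rpow _ _)), E by apply rpow_nonneg.
  rewrite rpow_mult by easy; f_equal; field; lra.
Qed.

Lemma box_component_estimate (d : nat) (p : R) :
  1 < p -> exists C, 0 <= C /\
  forall (L : nat) (F : point -> nat -> R) (u : point -> R) (j : nat),
    (1 <= L)%nat ->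
    (forall x i, ~ inBox d L x -> F x i = 0) ->
    (forall x, ~ inBox d L x -> u x = 0) ->
    (forall x, inBox d L x -> - lap d u x = div d F x) -> (j < d)%nat ->
    Sum (box d L) (fun x => rpow (Rabs (grad u x j)) p)
    <= C * Sum (seq 0 d) (fun i => Sum (box d L) (fun x => rpow (Rabs (F x i)) p)).
Proof.
intros Hp; destruct (box_duality_estimate d p Hp) as (C & HC & H).
(* The pairing scales by [k] but the [g] term does not, so it is absorbed. *)
set (k := C + 1).
exists (C * rpow k p); split; [apply Rmult_le_pos; [easy | apply rpow_nonneg]|].
intros L F u j HL HF Hu Heq Hj.
set (g := fun x => if in_dec (list_eq_dec Z.eq_dec) x (box d L)
  then grad u x j * rpow (Rabs (grad u x j)) (p - 2) else 0).
assert (Hg : forall x, ~ inBox d L x -> g x = 0).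
{ intros x Hx; unfold g; now destruct (in_dec _ _ _). }
assert (Hgin : forall x, inBox d L x -> g x = grad u x j * rpow (Rabs (grad u x j)) (p - 2)).
{ intros x Hx; unfold g; now destruct (in_dec _ _ _). }
specialize (H L (fun x i => k * F x i) (fun x => k * u x) g j HL).
set (X := Sum (box d L) (fun x => rpow (Rabs (grad u x j)) p)).
rewrite (Sum_ext (box d L) _ (fun x => k * rpow (Rabs (grad u x j)) p)) in H.
2:{ intros x Hx; rewrite grad_scal, Hgin, Rmult_assoc by easy; f_equal.
    now apply dual_power. }
rewrite Sum_scal in H; fold X in H.
rewrite (Sum_ext (box d L) (fun x => rpow (Rabs (g x)) _)
  (fun x => rpow (Rabs (grad u x j)) p)) in H.
2:{ intros x Hx; rewrite Hgin by easy; now apply dual_power. }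
fold X in H.
rewrite (Sum_ext (seq 0 d) _ (fun i => rpow k p *
  Sum (box d L) (fun x => rpow (Rabs (F x i)) p))) in H.
2:{ intros i _; rewrite <- Sum_scal; apply Sum_ext; intros x _.
    rewrite Rabs_mult, (Rabs_pos_eq k) by (unfold k; lra).
    apply rpow_mult_distr; [unfold k; lra | apply Rabs_pos]. }
rewrite Sum_scal in H.
assert (HX : k * X <= C * (rpow k p * Sum (seq 0 d) (fun i =>
  Sum (box d L) (fun x => rpow (Rabs (F x i)) p)) + X)).
{ apply H; try easy.
  - intros x i Hx; rewrite HF by easy; ring.
  - intros x Hx; rewrite Hu by easy; ring.
  - intros x Hx; rewrite lap_scal, div_scal, <- Heq by easy; ring. }
(* With [k = C + 1], subtracting [C X] leaves exactly [X]. *)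
unfold k in HX at 1; lra.
Qed.

Lemma vnorm_le_Sum (d : nat) (v : nat -> R) :
  vnorm d v <= Sum (seq 0 d) (fun i => Rabs (v i)).
Proof.
unfold vnorm, sum_dir.
assert (H0 : forall l : list nat, 0 <= Sum l (fun i => Rabs (v i)))
  by (intros; apply Sum_nonneg; intros; apply Rabs_pos).
apply Rsqr_incr_0_var; [|apply H0].
rewrite Rsqr_sqrt by (apply Sum_nonneg; intros; apply pow2_ge_0).
unfold Rsqr; induction (seq 0 d) as [|a l IH]; simpl; [lra|].
specialize (H0 l); pose proof (Rabs_pos (v a)); pose proof (pow2_abs (v a)).
simpl in *; nra.
Qed.

Lemma Rabs_le_vnorm (d : nat) (v : nat -> R) (i : nat) :
  (i < d)%nat -> Rabs (v i) <= vnorm d v.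
Proof.
intros Hi; unfold vnorm, sum_dir; rewrite <- sqrt_Rsqr_abs; apply sqrt_le_1_alt.
rewrite Rsqr_pow2; apply (Sum_ge_term (seq 0 d) (fun i => v i ^ 2)).
- intros; apply pow2_ge_0.
- apply in_seq; lia.
Qed.

(* For F supported in Lambda_L, K_{Lambda_L} F = grad u on Lambda_L where u
   vanishes outside Lambda_L and -Delta u = div F in Lambda_L. *)
Theorem mainTheorem10 (d : nat) (p : R) (hp : 1 < p) :
  exists C : R, forall (L : nat), (1 <= L)%nat ->
    forall (F : point -> nat -> R) (u : point -> R),
      (forall x i, ~ inBox d L x -> F x i = 0) ->
      (forall x, ~ inBox d L x -> u x = 0) ->
      (forall x, inBox d L x -> - lap d u x = div d F x) ->
      lpnorm d L p (grad u) <= C * lpnorm d L p F.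
Proof.
destruct (box_component_estimate d p hp) as (C & HC & H).
pose proof (pos_INR d) as Hd.
(* [rpow (INR d) p] comes from bounding the Euclidean norm by a sum of [d] components, one factor
   [INR d] from summing over the components of the gradient, the other from bounding each component
   of [F] by its norm. *)
exists (rpow (rpow (INR d) p * (INR d * (C * INR d))) (/ p)).
intros L HL F u HF Hu Heq; unfold lpnorm.
assert (Hn : forall v : nat -> R, 0 <= vnorm d v) by (intros; apply sqrt_pos).
assert (Hp : 0 <= / p) by (left; apply Rinv_0_lt_compat; lra).
rewrite <- rpow_mult_distr.
2:{ apply Rmult_le_pos; [apply rpow_nonneg|]; repeat apply Rmult_le_pos; easy. }
2:{ apply Sum_nonneg; intros; apply rpow_nonneg. }
apply rpow_le; [easy|]; split; [apply Sum_nonneg; intros; apply rpow_nonneg|].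
set (S := Sum (box d L) (fun x => rpow (vnorm d (F x)) p)).
assert (HS : Sum (seq 0 d) (fun i => Sum (box d L) (fun x => rpow (Rabs (F x i)) p))
  <= INR d * S).
{ rewrite <- (length_seq d 0) at 2; rewrite <- Sum_const.
  apply Sum_le; intros i Hi; apply in_seq in Hi; apply Sum_le; intros x _.
  apply rpow_le; [lra | split; [apply Rabs_pos | apply Rabs_le_vnorm; lia]]. }
apply Rle_trans with (rpow (INR d) p * Sum (seq 0 d) (fun j =>
  Sum (box d L) (fun x => rpow (Rabs (grad u x j)) p))).
- rewrite Sum_swap, <- Sum_scal; apply Sum_le; intros x _.
  eapply Rle_trans; [apply rpow_le; [lra | split; [apply Hn | apply vnorm_le_Sum]]|].
  rewrite <- (length_seq d 0) at 2.
  apply rpow_Sum_le; [lra | intros; apply Rabs_pos].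
- rewrite Rmult_assoc; apply Rmult_le_compat_l; [apply rpow_nonneg|].
  rewrite Rmult_assoc; rewrite <- (length_seq d 0) at 2; rewrite <- Sum_const.
  apply Sum_le; intros j Hj; apply in_seq in Hj.
  eapply Rle_trans; [apply (H L F u j); try easy; lia|].
  rewrite Rmult_assoc; now apply Rmult_le_compat_l.
Qed.
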